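(* Let $m\in\mathbb{R}$. If $p\in S^m$ then $p(-\Delta)$ maps $H^s$ into $H^{s-m}$, for all $s\in\mathbb{R}$ and all $m$.
   Context: Fractals. Let $K=\bigcup_{i=1}^M F_i(K)$ be the self-similar set of contractions $F_1,\dots,F_M$ of Euclidean space; for a word $\omega=\omega_1\cdots\omega_n$ put $F_\omega=F_{\omega_1}\circ\dots\circ F_{\omega_n}$. $K$ is post-critically finite (p.c.f.) if there is a subset $V_0$ of the fixed points of the $F_i$ (the boundary) with $F_\omega(K)\cap F_{\omega'}(K)\subseteq F_\omega(V_0)\cap F_{\omega'}(V_0)$ for all distinct words of equal length. $K$ carries a self-similar Dirichlet energy $\mathcal{E}(u)=\sum_i r_i^{-1}\mathcal{E}(u\circ F_i)$, a self-similar probability measure $\mu$, and the Laplacian defined weakly by $\Delta u=f$ iff $\mathcal{E}(u,v)=-\int fv\,d\mu$ for all $v\in\operatorname{dom}\mathcal{E}$ vanishing on $V_0$. A fractafold based on $K$ is a union of copies of $K$ of the same size glued at boundary points (compact iff finitely many copies; without boundary if all boundary points are paired). An infinite blow-up is $\bigcup_m F_{w_1}^{-1}\cdots F_{w_m}^{-1}K$ for an infinite word $w$. Energy, measure and Laplacian extend to these spaces and to products. Setting. $X$ is a compact fractafold without boundary based on a p.c.f. fractal $K$, an infinite blow-up of $K$ without boundary, or a product of copies of the same fractafold without boundary. If $X$ is non-compact, $\Delta$ has pure point spectrum, and $L^2(\mu)$ has an orthonormal basis $\{\phi_n\}$ of compactly supported eigenfunctions of $-\Delta$, with eigenvalues $\lambda_n$.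 $\Lambda$ is the spectrum (set of eigenvalues) of $-\Delta$ and $P_\lambda$ is the spectral projection for $\lambda\in\Lambda$. The heat kernel of $X$ satisfies $h_t(x,y)\le c_1t^{-d/(d+1)}\exp(-c_2(R(x,y)^{d+1}/t)^\gamma)$ for the (resistance) metric $R$ and constants $c_1,c_2,d,\gamma>0$; this fixes $d$. $S^m$ is the set of $p\in C^\infty((0,\infty))$ such that for every integer $k\ge0$ there is $C_k>0$ with $|(\lambda\frac{d}{d\lambda})^kp(\lambda)|\le C_k(1+\lambda)^{m/(d+1)}$ for all $\lambda>0$. $p(-\Delta)u=\sum_{\lambda\in\Lambda}p(\lambda)P_\lambda u$ (the operator acts on the eigenspaces with non-zero eigenvalues). Sobolev spaces. For $s\ge0$ and $u\in L^2(\mu)$, $\|u\|_{H^s}^2=\sum_{\lambda\in\Lambda}(1+\lambda)^{\frac{2s}{d+1}}\|P_\lambda u\|_2^2$, and $u\in H^s$ iff $\|u\|_{H^s}<\infty$. For $s>0$, $H^{-s}$ is the dual of $H^s$ via $\langle f,\varphi\rangle=\sum_n\langle f,\phi_n\rangle\overline{\langle\varphi,\phi_n\rangle}$ (elements of $H^{-s}$ are distributions, and $p(-\Delta)$ acts on them by multiplying the coefficients $\langle f,\phi_n\rangle$ by $p(\lambda_n)$). *)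

(* Defs.v *)
From HB Require Import structures.
From mathcomp Require Import all_boot all_order all_algebra.
From mathcomp Require Import finmap complex.
From mathcomp Require Import all_classical all_reals all_analysis.
Set Implicit Arguments.
Unset Strict Implicit.
Unset Printing Implicit Defensive.
Import Order.TTheory GRing.Theory Num.Theory.
Import numFieldNormedType.Exports.
Local Open Scope classical_set_scope.
Local Open Scope ring_scope.
Local Open Scope complex_scope.

(* the real-valued projections, masked by those of [numClosedFieldType] *)
Local Notation Re := complex.Re.
Local Notation Im := complex.Im.

(* joins the pointed and the topological structures of a product *)
HB.instance Definition _ (S T : ptopologicalType) := Topological.on (S * T)%type.

Definition borel (T : ptopologicalType) := g_sigma_algebraType (@open T).

(** * P.c.f. self-similar sets *)

(* The library norm on ['rV[R]_N] is the sup norm. *)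
Definition edist (R : realType) (N : nat) (x y : 'rV[R]_N) : R :=
  Num.sqrt (\sum_(i < N) (x ord0 i - y ord0 i) ^+ 2).

Definition is_contraction (R : realType) (N : nat) (f : 'rV[R]_N -> 'rV[R]_N) :=
  exists2 rho : R, rho < 1 & forall x y, edist (f x) (f y) <= rho * edist x y.

(* [word_map F [:: w1; ...; wn] = F w1 \o ... \o F wn] *)
Definition word_map (V : Type) (M : nat) (F : 'I_M -> V -> V) (w : seq 'I_M) :
    V -> V :=
  foldr (fun i f => F i \o f) id w.

Definition self_similar_set (R : realType) (N M : nat)
    (F : 'I_M -> 'rV[R]_N -> 'rV[R]_N) (K : set 'rV[R]_N) :=
  [/\ compact K, K !=set0 & K = \bigcup_(i in [set: 'I_M]) (F i @` K)].

Definition post_critically_finite (R : realType) (N M : nat)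
    (F : 'I_M -> 'rV[R]_N -> 'rV[R]_N) (K V0 : set 'rV[R]_N) :=
  (forall q, V0 q -> exists i, F i q = q) /\
  (forall w w' : seq 'I_M, size w = size w' -> w <> w' ->
     (word_map F w @` K) `&` (word_map F w' @` K) `<=`
     (word_map F w @` V0) `&` (word_map F w' @` V0)).

Definition self_similar_measure (R : realType) (N M : nat)
    (F : 'I_M -> 'rV[R]_N -> 'rV[R]_N) (K : set 'rV[R]_N) (p : 'I_M -> R)
    (mu : probability (borel 'rV[R]_N) R) :=
  [/\ forall i, 0 < p i,
      \sum_(i < M) p i = 1,
      mu (~` K) = 0%E &
      forall A : set (borel 'rV[R]_N), measurable A ->
        mu A = (\sum_(i < M) (p i)%:E * mu (F i @^-1` A))%E].

(* An energy is an extended-real valued quadratic form on all functions, equal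
   to [+oo] outside its domain.  Functions on [K] are represented by functions
   on the ambient space, of which only the values on [K] matter. *)
Record dirichlet_energy (R : realType) (N : nat) (K : set 'rV[R]_N)
    (mu : probability (borel 'rV[R]_N) R)
    (E : ('rV[R]_N -> R) -> \bar R) : Prop := {
  energy_ge0 : forall u, (0 <= E u)%E ;
  energy_local : forall u v, (forall x, K x -> u x = v x) -> E u = E v ;
  energy_continuous : forall u, (E u < +oo)%E -> {within K, continuous u} ;
  energy_homogeneous : forall (a : R) u,
    E (fun x => a * u x) = ((a ^+ 2)%:E * E u)%E ;
  energy_parallelogram : forall u v : 'rV[R]_N -> R,
    (E (u \+ v)%R + E (u \- v)%R = 2%:E * E u + 2%:E * E v)%E ;
  energy_eq0 : forall u : 'rV[R]_N -> R, E u = 0%E <-> exists a, forall x, K x -> u x = a ;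
  energy_markov : forall u : 'rV[R]_N -> R,
    (E (fun x => Num.min (Num.max (u x) 0) 1)%R <= E u)%E ;
  energy_dense : forall u e, {within K, continuous u} -> 0 < e ->
    exists2 v, (E v < +oo)%E & forall x, K x -> `|u x - v x| < e ;
  (* closedness of the form in [L^2(mu)] *)
  energy_closed : forall (un : nat -> 'rV[R]_N -> R) (u : 'rV[R]_N -> R),
    (forall n, (E (un n) < +oo)%E) ->
    measurable_fun [set: borel 'rV[R]_N] u ->
    (forall e : R, 0 < e -> exists n0, forall n n', (n0 <= n)%N -> (n0 <= n')%N ->
       (E (un n \- un n')%R < e%:E)%E) ->
    (\int[mu]_(x in K) ((un n x - u x) ^+ 2)%:E)%E @[n --> \oo] --> (0%E : \bar R) ->
    exists v, [/\ {ae mu, forall x, v x = u x}, (E v < +oo)%E &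
                  E (un n \- v) @[n --> \oo] --> (0%E : \bar R)]
}.

Record pcf_fractal (R : realType) := PcfFractal {
  fr_dim : nat ;
  fr_num : nat ;
  fr_map : 'I_fr_num -> 'rV[R]_fr_dim -> 'rV[R]_fr_dim ;
  fr_set : set 'rV[R]_fr_dim ;
  fr_bnd : set 'rV[R]_fr_dim ;
  fr_r : 'I_fr_num -> R ;
  fr_weight : 'I_fr_num -> R ;
  fr_mu : probability (borel 'rV[R]_fr_dim) R ;
  fr_energy : ('rV[R]_fr_dim -> R) -> \bar R ;
  fr_contraction : forall i, is_contraction (fr_map i) ;
  fr_self_similar : self_similar_set fr_map fr_set ;
  fr_pcf : post_critically_finite fr_map fr_set fr_bnd ;
  fr_mu_self_similar : self_similar_measure fr_map fr_set fr_weight fr_mu ;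
  fr_r_gt0 : forall i, 0 < fr_r i ;
  fr_dirichlet : dirichlet_energy fr_set fr_mu fr_energy ;
  fr_energy_self_similar : forall u,
    fr_energy u = (\sum_(i < fr_num) ((fr_r i)^-1)%:E * fr_energy (u \o fr_map i))%E
}.

Arguments fr_map {R} p i x.
Arguments fr_set {R} p x.
Arguments fr_bnd {R} p x.
Arguments fr_r {R} p i.
Arguments fr_weight {R} p i.
Arguments fr_energy {R} p u.

(** * Spaces with a measure, an energy and a metric *)

Record energy_space (R : realType) := Space {
  pt : ptopologicalType ;
  sp_mu : {measure set (borel pt) -> \bar R} ;
  sp_energy : (pt -> R) -> \bar R ;
  sp_dist : pt -> pt -> \bar R
}.

Arguments sp_energy {R} e u.
Arguments sp_dist {R} e x y.

(* [sup |u x - u y|^2 / E u], normalized so that two points separated by a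
   function of zero energy are at infinite distance *)
Definition resistance (R : realType) (T : Type) (E : (T -> R) -> \bar R)
    (x y : T) : \bar R :=
  ereal_sup [set ((u x - u y) ^+ 2)%:E | u in [set u | (E u <= 1)%E]].

(* [iota a] maps [K] onto the [a]-th copy; the topology is that of the gluing. *)
Definition fractafold_charts (R : realType) (A : pcf_fractal R) (X : energy_space R)
    (I : countType) (iota : I -> 'rV[R]_(fr_dim A) -> pt X) :=
  let K := fr_set A in let V0 := fr_bnd A in
  [/\ forall z, exists a x, K x /\ iota a x = z,
      forall a b x y, K x -> K y -> iota a x = iota b y ->
        (a, x) = (b, y) \/ (V0 x /\ V0 y),
      forall C : set (pt X), closed C <-> forall a, closed (K `&` iota a @^-1` C) &
      [/\ forall B : set (borel (pt X)), measurable B ->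
            sp_mu X B = (\esum_(a in [set: I]) fr_mu A (K `&` iota a @^-1` B))%E,
          forall u, sp_energy X u =
            (\esum_(a in [set: I]) fr_energy A (u \o iota a))%E &
          forall x y, sp_dist X x y = resistance (sp_energy X) x y]].

(* without boundary: each boundary point of each copy is identified with
   exactly one other boundary point *)
Definition fractafold (R : realType) (A : pcf_fractal R) (X : energy_space R) :=
  exists (I : countType) (iota : I -> 'rV[R]_(fr_dim A) -> pt X),
    fractafold_charts iota /\
    forall a q, fr_bnd A q -> exists! bq : I * 'rV[R]_(fr_dim A),
      [/\ bq <> (a, q), fr_bnd A bq.2 & iota bq.1 bq.2 = iota a q].

(* [blow_map F w m = F (w m.-1) \o ... \o F (w 0)], so that
   [blow_map F w m @^-1` K] is [F (w 0)]^-1 ... [F (w m.-1)]^-1 K *)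
Fixpoint blow_map (V : Type) (M : nat) (F : 'I_M -> V -> V) (w : nat -> 'I_M)
    (m : nat) (x : V) : V :=
  if m is m'.+1 then F (w m') (blow_map F w m' x) else x.

(* [j] identifies the points of [X] with those of the blow-up in Euclidean
   space, [psi m] is the inverse of the [m]-th expanding map, from [K] to [X];
   [X] has the topology of the increasing union.  The suprema are limits of
   nondecreasing sequences.  A boundary point of the blow-up would be a boundary
   point of all sufficiently large copies of [K]. *)
Definition infinite_blowup (R : realType) (A : pcf_fractal R) (X : energy_space R) :=
  let K := fr_set A in let V0 := fr_bnd A in let F := fr_map A in
  exists (w : nat -> 'I_(fr_num A)) (j : pt X -> 'rV[R]_(fr_dim A))
         (psi : nat -> 'rV[R]_(fr_dim A) -> pt X),
    [/\ forall i, bijective (F i),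
        injective j /\ range j = \bigcup_m (blow_map F w m @^-1` K),
        forall m x, K x -> blow_map F w m (j (psi m x)) = x,
        forall C : set (pt X), closed C <-> forall m, closed (K `&` psi m @^-1` C) &
        [/\ forall B : set (borel (pt X)), measurable B ->
              sp_mu X B = ereal_sup [set
                (((\prod_(i < m) fr_weight A (w i))^-1)%:E *
                 fr_mu A (K `&` psi m @^-1` B))%E | m in [set: nat]],
            forall u, sp_energy X u = ereal_sup [set
                ((\prod_(i < m) fr_r A (w i))%:E *
                 fr_energy A (u \o psi m))%E | m in [set: nat]],
            forall x y, sp_dist X x y = resistance (sp_energy X) x y &
            ~ exists x m0, forall m, (m0 <= m)%N -> V0 (blow_map F w m (j x))]].

(* The energy of an almost everywhere class of functions. *)
Definition energy_ae (R : realType) (X : energy_space R) (u : pt X -> R) : \bar R :=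
  ereal_inf [set sp_energy X v | v in [set v | {ae sp_mu X, forall x, v x = u x}]].

Definition product_energy (R : realType) (X Y : energy_space R) (u : pt X * pt Y -> R) :
    \bar R :=
  ((\int[sp_mu Y]_y energy_ae (X := X) (fun x => u (x, y))) +
   (\int[sp_mu X]_x energy_ae (X := Y) (fun y => u (x, y))))%E.

Definition is_product_measure (R : realType) (X Y : energy_space R)
    (nu : {measure set (borel (pt X * pt Y)%type) -> \bar R}) :=
  forall (B : set (borel (pt X))) (C : set (borel (pt Y))),
    measurable B -> measurable C -> nu (B `*` C) = (sp_mu X B * sp_mu Y C)%E.

Definition product_space (R : realType) (X Y : energy_space R)
    (nu : {measure set (borel (pt X * pt Y)%type) -> \bar R}) : energy_space R :=
  {| pt := (pt X * pt Y)%type ;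
     sp_mu := nu ;
     sp_energy := @product_energy _ X Y ;
     sp_dist := fun z z' =>
       maxe (sp_dist X z.1 z'.1) (sp_dist Y z.2 z'.2) |}.

Inductive power_of (R : realType) (X : energy_space R) : nat -> energy_space R -> Prop :=
| power_one : power_of X 1 X
| power_succ n Y nu : power_of X n Y -> @is_product_measure _ X Y nu ->
    power_of X n.+1 (product_space nu).

(* [k] is the number of factors. *)
Definition admissible (R : realType) (A : pcf_fractal R) (k : nat) (X : energy_space R) :=
  [\/ k = 1%N /\ (fractafold A X /\ compact [set: pt X]),
      k = 1%N /\ infinite_blowup A X |
      (1 < k)%N /\ exists Y, (fractafold A Y \/ infinite_blowup A Y) /\ power_of Y k X].

(** * Complex [L^2] *)

Section L2.
Context {R : realType} {T : ptopologicalType}.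
Variable mu : {measure set (borel T) -> \bar R}.
Implicit Types u v : T -> R[i].

Definition in_L2r (u : T -> R) :=
  measurable_fun [set: borel T] u /\ (\int[mu]_x ((u x) ^+ 2)%:E < +oo)%E.

Definition abs2 (z : R[i]) : R := Re z ^+ 2 + Im z ^+ 2.

Definition L2norm2 u : \bar R := (\int[mu]_x (abs2 (u x))%:E)%E.

Definition in_L2 u :=
  [/\ measurable_fun [set: borel T] (fun x => Re (u x)),
      measurable_fun [set: borel T] (fun x => Im (u x)) & (L2norm2 u < +oo)%E].

Definition cintegral u : R[i] :=
  (\int[mu]_x Re (u x)) +i* (\int[mu]_x Im (u x)).

Definition inner u v : R[i] := cintegral (fun x => u x * (v x)^*).

Definition closed_span (S : set (T -> R[i])) : set (T -> R[i]) :=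
  [set v | in_L2 v /\ forall e : R, 0 < e ->
     exists (n : nat) (c : 'I_n -> R[i]) (w : 'I_n -> T -> R[i]),
       (forall i, S (w i)) /\
       (L2norm2 (fun x => v x - \sum_(i < n) c i * w i x)%R < e%:E)%E].

(* The value at [u] of the orthogonal projection onto [closed_span S], up to
   almost everywhere equality. *)
Definition orth_proj (S : set (T -> R[i])) u : T -> R[i] :=
  xget (fun=> 0) [set v | closed_span S v /\
    forall w, S w -> inner (fun x => u x - v x) w = 0].

End L2.

(** * The Laplacian and its functional calculus *)

Section Laplacian.
Context {R : realType}.
Variable X : energy_space R.
Implicit Types u v : pt X -> R[i].

Definition energy_bil (u v : pt X -> R) : R :=
  (fine (sp_energy X (u \+ v)) - fine (sp_energy X (u \- v))) / 4.

(* [Delta u = f] in the weak sense; [X] has no boundary. *)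
Definition laplacian (u f : pt X -> R) :=
  [/\ in_L2r (sp_mu X) u, (sp_energy X u < +oo)%E, in_L2r (sp_mu X) f &
      forall v : pt X -> R, in_L2r (sp_mu X) v -> (sp_energy X v < +oo)%E ->
        energy_bil u v = - \int[sp_mu X]_x (f x * v x)].

(* [- Delta u = l u] *)
Definition eigenspace (l : R) : set (pt X -> R[i]) :=
  [set u | laplacian (fun x => Re (u x)) (fun x => - (l * Re (u x))) /\
           laplacian (fun x => Im (u x)) (fun x => - (l * Im (u x)))].

Definition Lambda : set R :=
  [set l | exists2 u, eigenspace l u & L2norm2 (sp_mu X) u <> 0%E].

Definition spectral_proj (l : R) (u : pt X -> R[i]) : pt X -> R[i] :=
  orth_proj (sp_mu X) (eigenspace l) u.

(* [v = \sum_(l in D) q l *: P_l u], unconditional convergence in [L^2] *)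
Definition spectral_sum (D : set R) (q : R -> R[i]) u v :=
  in_L2 (sp_mu X) v /\
  forall e : R, 0 < e -> exists J0 : {fset R}, [set` J0] `<=` D /\
    forall J : {fset R}, [set` J0] `<=` [set` J] -> [set` J] `<=` D ->
      (L2norm2 (sp_mu X)
         (fun x => v x - \sum_(l <- J) q l * spectral_proj l u x)%R < e%:E)%E.

(* Orthonormal basis of [L^2] made of compactly supported eigenfunctions (the
   support condition is void when [X] is compact). *)
Definition eigenbasis (phi : nat -> pt X -> R[i]) (lam : nat -> R) :=
  [/\ forall n, eigenspace (lam n) (phi n),
      forall n m, inner (sp_mu X) (phi n) (phi m) = (n == m)%:R,
      forall u, in_L2 (sp_mu X) u -> closed_span (sp_mu X) (range phi) u &
      forall n, exists2 C : set (pt X), compact C & forall x, ~ C x -> phi n x = 0].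

(* [h] is the kernel of [exp(t Delta)]. *)
Definition heat_kernel (h : R -> pt X -> pt X -> R) :=
  forall t, 0 < t ->
    [/\ measurable_fun [set: (borel (pt X) * borel (pt X))%type]
          (fun z => h t z.1 z.2),
        forall x, in_L2r (sp_mu X) (h t x) &
        forall u, in_L2 (sp_mu X) u ->
          spectral_sum Lambda (fun l => (expR (- (t * l)))%:C) u
            (fun x => cintegral (sp_mu X) (fun y => (h t x y)%:C * u y))].

(* For a product of [k] copies the on-diagonal factor [t ^ - (d / (d + 1))] of
   the estimate comes with multiplicity [k].  The bound is for small times: it
   fails for large [t] when [X] is compact, since [0] is then an eigenvalue. *)
Definition heat_kernel_bound (k : nat) (d : R) :=
  exists h, heat_kernel h /\
  exists c1 c2 gamma : R, [/\ 0 < c1, 0 < c2, 0 < gamma &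
    forall t x y, 0 < t <= 1 ->
      ((h t x y)%:E <= (c1 * t `^ (- (k%:R * d / (d + 1))))%R%:E *
        expeR (- (c2%:E *
          (((sp_dist X x y `^ (d + 1)) * (t^-1)%:E) `^ gamma))))%E].

End Laplacian.

(** * Symbols *)

(* [l |-> l * p'(l)], for a complex-valued [p] *)
Definition euler (R : realType) (p : R -> R[i]) : R -> R[i] := fun l =>
  (l * derive1 (fun x => Re (p x)) l) +i* (l * derive1 (fun x => Im (p x)) l).

(* The values of [p] outside of [(0, +oo)] are irrelevant. *)
Definition symbol_class (R : realType) (d m : R) : set (R -> R[i]) :=
  [set p |
    (forall n l, 0 < l -> derivable (derive1n n (fun x => Re (p x))) l 1 /\
                          derivable (derive1n n (fun x => Im (p x))) l 1) /\
    (forall k : nat, exists2 Ck : R, 0 < Ck & forall l, 0 < l ->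
       Num.sqrt (abs2 (iter k (@euler R) p l)) <= Ck * (1 + l) `^ (m / (d + 1)))].

(** * Sobolev spaces *)

Section Sobolev.
Context {R : realType}.
Variables (X : energy_space R) (d : R).

Definition sobolev_norm2 (s : R) (u : pt X -> R[i]) : \bar R :=
  (\esum_(l in Lambda X)
     ((1 + l) `^ (2 * s / (d + 1)))%:E * L2norm2 (sp_mu X) (spectral_proj l u))%E.

Definition sobolev_fun (s : R) : set (pt X -> R[i]) :=
  [set u | in_L2 (sp_mu X) u /\ (sobolev_norm2 s u < +oo)%E].

(* Bounded functionals on [H^s].  They are conjugate-linear, as is
   [f |-> \sum_n <f, phi_n> (<f, phi_n>)^*] in its second argument; their values
   outside of [H^s] are irrelevant. *)
Definition sobolev_dual (s : R) : set ((pt X -> R[i]) -> R[i]) :=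
  [set f |
    (forall (a : R[i]) u v, sobolev_fun s u -> sobolev_fun s v ->
       f (fun x => a * u x + v x) = a^* * f u + f v) /\
    exists C : R, forall u, sobolev_fun s u ->
      ((abs2 (f u))%:E <= C%:E * sobolev_norm2 s u)%E].

Inductive gen_fun :=
| Fn of (pt X -> R[i])
| Dist of ((pt X -> R[i]) -> R[i]).

Definition sobolev (s : R) : set gen_fun :=
  [set g | match g with
           | Fn u => 0 <= s /\ sobolev_fun s u
           | Dist f => s < 0 /\ sobolev_dual (- s) f
           end].

Definition coefficient (phi : nat -> pt X -> R[i]) (g : gen_fun) (n : nat) : R[i] :=
  match g with
  | Fn u => inner (sp_mu X) u (phi n)
  | Dist f => f (phi n)
  end.

(* [g' = p(- Delta) g].  The eigenvalue [0], where [p] is not defined, does not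
   contribute. *)
Definition psi_do (phi : nat -> pt X -> R[i]) (lam : nat -> R) (p : R -> R[i])
    (g g' : gen_fun) :=
  match g, g' with
  | Fn u, Fn v => spectral_sum (Lambda X `\ 0) p u v
  | _, _ => forall n, coefficient phi g' n =
      (if lam n == 0 then 0 else p (lam n)) * coefficient phi g n
  end.

End Sobolev.

(* Main.v *)
Require Import Defs.
From HB Require Import structures.
From mathcomp Require Import all_boot all_order all_algebra.
From mathcomp Require Import finmap complex.
From mathcomp Require Import all_classical all_reals all_analysis.
From mathcomp Require Import measurable_realfun ring lra.
Import Order.TTheory GRing.Theory Num.Theory.
Import numFieldNormedType.Exports.
Local Open Scope classical_set_scope.
Local Open Scope ring_scope.

(** In the eigenbasis [phi], everything is diagonal.  Writing [b n] for the
    coefficient of a function or distribution on [phi n], the space [H^s] is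
    the space of sequences such that
    [\sum_n (1 + lam n) ^ (2 s / (d + 1)) * `|b n| ^ 2] is finite, for positive
    and for negative [s], and [p(- Delta)] multiplies [b n] by [p (lam n)].  The
    estimate [`|p(l)| <= C (1 + l) ^ (m / (d + 1))] therefore replaces the weight
    of exponent [s] by that of exponent [s - m], which is the theorem
    ([weighted_norm2_symbol]).  The work lies in this dictionary.

    - That elements of [H^s] have coefficients in the weighted space
      ([sobolev_coef]) is Parseval's identity for [s >= 0]; for [s < 0] a functional
      is tested on truncations of its Riesz representative
      ([sobolev_dual_coef]).
    - That every sequence of the weighted space comes from an element of [H^s]
      ([sobolev_of_coef]) is the Riesz-Fischer theorem for [s >= 0]
      ([riesz_fischer], which rests on the completeness of [L^2],
      [L2_complete]); for [s < 0] the functional is an inner product between two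
      functions that share the weight ([sobolev_dual_of_coef]).
    - The spectral projection on [l] keeps the coefficients of index [n] with
      [lam n = l] and kills the others ([spectral_projP]), which expresses
      Sobolev norms and spectral sums by coefficients ([sobolev_norm2E],
      [spectral_sumP]).  This needs the orthogonality of eigenfunctions of
      distinct eigenvalues, that is, the symmetry of the energy form.
    - A symbol is only controlled on the positive half-line, so eigenvalues must
      be nonnegative ([lam_ge0]).  This and the symmetry of the form hold because
      the energy is nonnegative and homogeneous of degree two, for every
      space under consideration ([quadratic_admissible]). *)

Set Implicit Arguments.
Unset Strict Implicit.
Unset Printing Implicit Defensive.

Local Open Scope complex_scope.
(* Both scopes define the conjugation [^*]; the one of [ring_scope] comes with
   the theory of morphisms. *)
Local Open Scope ring_scope.
Local Notation Re := complex.Re.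
Local Notation Im := complex.Im.

(** * Completeness of the real Hilbert space of square-integrable functions *)

Section RealL2.
Context {R : realType} {T : ptopologicalType}.
Variable mu : {measure set (borel T) -> \bar R}.
Implicit Types f g h : T -> R.

Lemma in_L2rP f : in_L2r mu f <->
  measurable_fun [set: borel T] f /\
  mu.-integrable [set: borel T] (EFin \o (fun x => f x ^+ 2)).
Proof.
split=> -[mf If]; split=> //.
  apply/integrableP; split; first by apply/measurable_EFinP; exact: measurable_funX.
  by under eq_integral do rewrite /= ger0_norm ?sqr_ge0 //.
have /integrableP[_] := If.
by under eq_integral do rewrite /= ger0_norm ?sqr_ge0 //.
Qed.

Lemma integrable_L2rM f g : in_L2r mu f -> in_L2r mu g ->
  mu.-integrable [set: borel T] (EFin \o (fun x => f x * g x)).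
Proof.
move=> /in_L2rP[mf If] /in_L2rP[mg Ig].
have mfg : measurable_fun [set: borel T] (fun x => f x * g x).
  exact: measurable_funM.
apply: (le_integrable measurableT _ _ (integrableD measurableT If Ig)) => //.
  exact/measurable_EFinP.
move=> x _ /=; rewrite lee_fin.
rewrite [leRHS]ger0_norm ?addr_ge0 ?sqr_ge0 //.
rewrite ler_norml; apply/andP; split; nra.
Qed.

Lemma in_L2r_lin (a b : R) f g : in_L2r mu f -> in_L2r mu g ->
  in_L2r mu (fun x => a * f x + b * g x).
Proof.
move=> L2f L2g; have [mf If] := iffLR (in_L2rP f) L2f.
have [mg Ig] := iffLR (in_L2rP g) L2g.
apply/in_L2rP; split.
  by apply: measurable_funD; apply: measurable_funM => //; exact: measurable_cst.
have Ifg := integrable_L2rM L2f L2g.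
have /= := integrableD measurableT (integrableZl measurableT (a ^+ 2) If)
  (integrableD measurableT (integrableZl measurableT (b ^+ 2) Ig)
     (integrableZl measurableT (2 * a * b) Ifg)).
apply: eq_integrable => // x _ /=.
by rewrite -?EFinM -?EFinD; congr EFin; ring.
Qed.

Lemma in_L2r_sub f g : in_L2r mu f -> in_L2r mu g ->
  in_L2r mu (fun x => f x - g x).
Proof.
move=> Lf Lg; have := in_L2r_lin 1 (- 1) Lf Lg.
by congr (in_L2r _ _); apply/funext => x /=; rewrite mul1r mulN1r.
Qed.

(** Riesz-Fischer.  A subsequence [h] whose increments [a k] have square norms
    at most [4 ^- k] converges almost everywhere, because [2 `|a k|] is at most
    [2 ^- k + 2 ^ k (a k) ^ 2] and the integral of [\sum_k 2 ^ k (a k) ^ 2] is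
    finite.  Fatou's lemma then turns the Cauchy estimate between [f n] and
    [h k] into an estimate between [f n] and the limit. *)
Lemma L2r_complete (f : nat -> T -> R) :
    (forall n, in_L2r mu (f n)) ->
    (forall e : R, 0 < e -> exists N, forall i j, (N <= i)%N -> (N <= j)%N ->
       (\int[mu]_x ((f i x - f j x) ^+ 2)%:E <= e%:E)%E) ->
  exists2 g, in_L2r mu g & forall e : R, 0 < e -> exists N, forall i, (N <= i)%N ->
       (\int[mu]_x ((f i x - g x) ^+ 2)%:E <= e%:E)%E.
Proof.
move=> L2f cauchy.
have sq_ge0 (a : R) : (0 <= (a ^+ 2)%:E)%E by rewrite lee_fin sqr_ge0.
have mf n : measurable_fun [set: borel T] (f n) by have [] := L2f n.
have /choice[N0 N0P] : forall k : nat, exists N, forall i j, (N <= i)%N -> (N <= j)%N ->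
    (\int[mu]_x ((f i x - f j x) ^+ 2)%:E <= ((1 / 4) ^+ k)%:E)%E.
  by move=> k; apply: cauchy; rewrite exprn_gt0.
(* The extra summand [k] makes the extracted indices unbounded. *)
pose M k := (k + \sum_(i < k.+1) N0 i)%N.
have MS k : (M k <= M k.+1)%N.
  by rewrite /M [X in (_ <= _ + X)%N]big_ord_recr /= leq_add // leq_addr.
have N0M k : (N0 k <= M k)%N.
  by rewrite /M big_ord_recr /= addnA leq_addl.
have kM k : (k <= M k)%N by rewrite /M leq_addr.
pose h k := f (M k).
have mh k : measurable_fun [set: borel T] (h k) by exact: mf.
pose a k x := h k.+1 x - h k x.
have ma k : measurable_fun [set: borel T] (a k) by exact: measurable_funB.
have Ia k : (\int[mu]_x ((a k x) ^+ 2)%:E <= ((1 / 4) ^+ k)%:E)%E.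
  by apply: N0P => //; apply: leq_trans (MS _).
pose G x := (\sum_(k <oo) (2 ^+ k * (a k x) ^+ 2)%:E)%E.
have mG' k : measurable_fun [set: borel T] (fun x => (2 ^+ k * (a k x) ^+ 2)%:E).
  apply/measurable_EFinP; apply: measurable_funM; first exact: measurable_cst.
  exact: measurable_funX.
have G'0 k x : (0 <= (2 ^+ k * (a k x) ^+ 2)%:E)%E.
  by rewrite lee_fin mulr_ge0 ?sqr_ge0 ?exprn_ge0.
have IG : (\int[mu]_x G x < +oo)%E.
  rewrite /G integral_nneseries //.
  apply: (@le_lt_trans _ _ (\sum_(k <oo) ((1 / 2) ^+ k)%:E)%E).
    apply: lee_nneseries => [k _ _|k _]; first exact: integral_ge0.
    under eq_integral do rewrite EFinM.
    rewrite ge0_integralZl_EFin // ?exprn_ge0 //; last first.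
      by apply/measurable_EFinP; exact: measurable_funX.
    apply: (@le_trans _ _ ((2 ^+ k)%:E * ((1 / 4) ^+ k)%:E)%E).
      by apply: lee_pmul => //; rewrite ?lee_fin ?exprn_ge0 // integral_ge0.
    rewrite -EFinM -exprMn lee_fin.
    by rewrite (_ : 2 * (1 / 4) = 1 / 2 :> R) //; lra.
  under eq_eseriesr => k _.
    rewrite (_ : (1 / 2) ^+ k = 2 / (2 ^ (k + 1))%:R :> R); last first.
      by rewrite expnD natrM natrX expr_div_n expr1n; field; rewrite expf_neq0.
    over.
  have /cvg_lim := @cvg_geometric_eseries_half R 2 0.
  by rewrite /eseries /= => ->; rewrite ?ltry.
have mG : measurable_fun [set: borel T] G.
  exact: ge0_emeasurable_sum.
have Gfin : {ae mu, forall x, [set: borel T] x -> G x \is a fin_num}.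
  apply: integrable_ae => //; apply/integrableP; split => //.
  by under eq_integral do rewrite gee0_abs ?nneseries_ge0 //.
(* An upper limit is measurable in [x] even where the sequence diverges. *)
pose g x := fine (limn_esup (fun k => (h k x)%:E)).
have mg : measurable_fun [set: borel T] g.
  apply: measurableT_comp => //.
  by apply: measurable_fun_limn_esup => k; exact/measurable_EFinP.
have hg : {ae mu, forall x, [set: borel T] x -> h ^~ x @ \oo --> g x}.
  apply: filterS Gfin => x /(_ I) Gx _.
  have cv1 : cvgn (series (fun k => 2 ^+ k * (a k x) ^+ 2)).
    apply: nnseries_is_cvg => [i|]; first by rewrite mulr_ge0 ?sqr_ge0 ?exprn_ge0.
    by move: Gx; rewrite fin_numElt => /andP[].
  have cv2 : cvgn (series (geometric (1 : R) (1 / 2))).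
    by apply: is_cvg_geometric_series; rewrite ger0_norm //; lra.
  have cv3 : cvgn [normed series (a ^~ x)].
    apply: (@series_le_cvg _ _ (geometric 1 (1 / 2) \+ (fun k => 2 ^+ k * (a k x) ^+ 2))).
    - by move=> n /=; exact: normr_ge0.
    - move=> n /=; rewrite mul1r; apply: addr_ge0; first by rewrite exprn_ge0 ?divr_ge0.
      by rewrite mulr_ge0 ?sqr_ge0 ?exprn_ge0.
    - move=> k /=.
      have p0 : (0 : R) < 2 ^+ k by rewrite exprn_gt0.
      rewrite mul1r expr_div_n expr1n -(real_normK (num_real (a k x))).
      move: (`|a k x|) => y; rewrite -subr_ge0.
      rewrite (_ : _ - _ = (1 - 2 ^+ k * y + (2 ^+ k * y) ^+ 2) / 2 ^+ k); last first.
        by field; rewrite gt_eqF.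
      by rewrite divr_ge0 ?(ltW p0) //; move: (2 ^+ k * y) => z; nra.
    - exact: is_cvg_seriesD.
  have cvh : cvgn (h ^~ x).
    have /normed_cvg cv4 := cv3.
    rewrite (_ : h ^~ x = (fun n => h 0 x + series (a ^~ x) n)); last first.
      by apply/funext => n; rewrite (eq_sum_telescope (h ^~ x) n).
    by apply: is_cvgD => //; exact: is_cvg_cst.
  rewrite /g.
  have hl : (fun k => (h k x)%:E) @ \oo --> (limn (h ^~ x))%:E.
    by apply: cvg_EFin => //; exact: nearW.
  by rewrite is_cvg_limn_esupE ?(cvg_lim _ hl) //; exact: (cvgP _ hl).
have bound n N (e : R) : (forall i j, (N <= i)%N -> (N <= j)%N ->
       (\int[mu]_x ((f i x - f j x) ^+ 2)%:E <= e%:E)%E) -> (N <= n)%N ->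
    (\int[mu]_x ((f n x - g x) ^+ 2)%:E <= e%:E)%E.
  move=> NP Nn; pose F k x := ((f n x - h k x) ^+ 2)%:E.
  have mF k : measurable_fun [set: borel T] (F k).
    by apply/measurable_EFinP; apply: measurable_funX; exact: measurable_funB.
  have F0 k x : [set: borel T] x -> (0 <= F k x)%E by move=> _; exact: sq_ge0.
  rewrite (@ge0_ae_eq_integral _ (borel T) R mu setT _ (fun x => limn_einf (F ^~ x))) //.
  - apply: le_trans (fatou mu measurableT mF F0) _.
    rewrite limn_einf_lim; apply: lime_le; first exact: is_cvg_einfs.
    apply: nearW => k; apply: (@le_trans _ _ (\int[mu]_x F (maxn k N) x)%E).
      by apply: ereal_inf_lbound => /=; exists (maxn k N) => //=; exact: leq_maxl.
    by apply: NP => //; rewrite (leq_trans (leq_maxr k N)).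
  - by apply/measurable_EFinP; apply: measurable_funX; exact: measurable_funB.
  - rewrite (_ : (fun x => _) = (fun x => - limn_esup (fun k => - F k x))%E); last first.
      by apply/funext => x; rewrite (limn_esupN (F ^~ x)) oppeK.
    apply: measurableT_comp => //; apply: measurable_fun_limn_esup => k.
    exact: measurableT_comp.
  - move=> x _; rewrite limn_einf_lim; apply: lime_ge; first exact: is_cvg_einfs.
    by apply: nearW => k; apply: le_ereal_inf_tmp => _ [i _ <-]; exact: F0.
  - apply: filterS hg => x /[apply] hgx.
    have /cvg_limn_einf_sup[-> _] // : F ^~ x @ \oo --> ((f n x - g x) ^+ 2)%:E.
    apply: cvg_EFin; first exact: nearW.
    apply: (@cvg_comp _ _ _ _ (fun y : R => y ^+ 2) _ (nbhs (f n x - g x))).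
      by apply: cvgB => //; exact: cvg_cst.
    exact: exprn_continuous.
exists g.
  have [N NP] := cauchy 1 ltr01.
  have := bound N N 1 NP (leqnn N) => b1.
  suff : in_L2r mu (fun x => f N x - (f N x - g x)).
    by congr in_L2r; apply/funext => x; rewrite opprB addrC subrK.
  apply: in_L2r_sub => //; split; first exact: measurable_funB.
  by apply: le_lt_trans b1 _; rewrite ltry.
move=> e /cauchy[N NP]; exists N => i Ni; exact: bound NP Ni.
Qed.
End RealL2.

(** * Complex numbers in coordinates *)

Section ComplexNumbers.
Context {R : realType}.
Implicit Types z w : R[i].

Lemma ReD z w : Re (z + w) = Re z + Re w. Proof. by case: z w => ? ? []. Qed.
Lemma ImD z w : Im (z + w) = Im z + Im w. Proof. by case: z w => ? ? []. Qed.
Lemma ReN z : Re (- z) = - Re z. Proof. by case: z. Qed.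
Lemma ImN z : Im (- z) = - Im z. Proof. by case: z. Qed.
Lemma ReM z w : Re (z * w) = Re z * Re w - Im z * Im w.
Proof. by case: z w => ? ? []. Qed.
Lemma ImM z w : Im (z * w) = Re z * Im w + Im z * Re w.
Proof. by case: z w => ? ? []. Qed.
Lemma ReC z : Re z^* = Re z. Proof. by case: z. Qed.
Lemma ImC z : Im z^* = - Im z. Proof. by case: z. Qed.
Definition complexRI := (ReD, ImD, ReN, ImN, ReM, ImM, ReC, ImC).

Lemma complex_eq z w : Re z = Re w -> Im z = Im w -> z = w.
Proof. by case: z w => ? ? [? ?] /= -> ->. Qed.

Lemma abs2_ge0 z : 0 <= abs2 z.
Proof. by rewrite addr_ge0 ?sqr_ge0. Qed.

Lemma abs20 : abs2 (0 : R[i]) = 0.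
Proof. by rewrite /abs2 /= expr0n addr0. Qed.

Lemma abs2_eq0 z : abs2 z = 0 -> z = 0.
Proof.
move=> /eqP; rewrite paddr_eq0 ?sqr_ge0 // !sqrf_eq0 => /andP[/eqP a /eqP b].
exact: complex_eq.
Qed.

Lemma abs2M z w : abs2 (z * w) = abs2 z * abs2 w.
Proof. by rewrite /abs2 !complexRI; ring. Qed.

Lemma abs2C z : abs2 z^* = abs2 z.
Proof. by rewrite /abs2 !complexRI; ring. Qed.

Lemma abs2_real (r : R) : abs2 r%:C = r ^+ 2.
Proof. by rewrite /abs2 /= expr0n addr0. Qed.

Lemma mul_conj z : z * z^* = (abs2 z)%:C.
Proof. by apply: complex_eq; rewrite !complexRI /abs2 /=; ring. Qed.

End ComplexNumbers.

(** * The sesquilinear pairing of square-integrable functions *)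

Section ComplexL2.
Context {R : realType} {T : ptopologicalType}.
Variable mu : {measure set (borel T) -> \bar R}.
Implicit Types (u v w : T -> R[i]) (a : R[i]).

Notation L2 := (in_L2 mu).
Notation "<< u , v >>" := (inner mu u v).

Definition cintegrable u :=
  mu.-integrable [set: borel T] (EFin \o (fun x => Re (u x))) /\
  mu.-integrable [set: borel T] (EFin \o (fun x => Im (u x))).

(** The real and imaginary parts of the functions to be integrated are all
    combinations of two integrable functions, which this lemma and the next
    handle in one step. *)
Lemma integrable_comb (c1 c2 : R) (f g h : T -> R) :
  mu.-integrable [set: borel T] (EFin \o f) ->
  mu.-integrable [set: borel T] (EFin \o g) ->
  (forall x, h x = c1 * f x + c2 * g x) ->
  mu.-integrable [set: borel T] (EFin \o h).
Proof.
move=> If Ig hE.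
have := integrableD measurableT (integrableZl measurableT c1 If)
  (integrableZl measurableT c2 Ig).
by apply: eq_integrable => // x _ /=; rewrite hE EFinD !EFinM.
Qed.

Lemma Rintegral_comb (c1 c2 : R) (f g h : T -> R) :
  mu.-integrable [set: borel T] (EFin \o f) ->
  mu.-integrable [set: borel T] (EFin \o g) ->
  (forall x, h x = c1 * f x + c2 * g x) ->
  \int[mu]_x h x = c1 * \int[mu]_x f x + c2 * \int[mu]_x g x.
Proof.
move=> If Ig hE.
rewrite -(RintegralZl c1 measurableT If) -(RintegralZl c2 measurableT Ig).
rewrite -RintegralD //.
- by apply: eq_Rintegral => x _; rewrite hE.
- by have := integrableZl measurableT c1 If; apply: eq_integrable.
- by have := integrableZl measurableT c2 Ig; apply: eq_integrable.
Qed.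

Lemma cintegral_lin a u v : cintegrable u -> cintegrable v ->
  cintegral mu (fun x => a * u x + v x) = a * cintegral mu u + cintegral mu v.
Proof.
move=> [Ru Iu] [Rv Iv]; apply: complex_eq; rewrite !complexRI /=.
  rewrite (@Rintegral_comb 1 1 (fun x => Re a * Re (u x) - Im a * Im (u x))
     (fun x => Re (v x))) //; last 2 first.
  - apply: (integrable_comb (c1 := Re a) (c2 := - Im a) Ru Iu) => x; ring.
  - by move=> x; rewrite !complexRI; ring.
  rewrite (Rintegral_comb (c1 := Re a) (c2 := - Im a) Ru Iu); first ring.
  by move=> x; ring.
rewrite (@Rintegral_comb 1 1 (fun x => Re a * Im (u x) + Im a * Re (u x))
     (fun x => Im (v x))) //; last 2 first.
- apply: (integrable_comb (c1 := Re a) (c2 := Im a) Iu Ru) => x; ring.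
- by move=> x; rewrite !complexRI; ring.
rewrite (Rintegral_comb (c1 := Re a) (c2 := Im a) Iu Ru); first ring.
by move=> x; ring.
Qed.

Lemma L2norm2_ReIm u : measurable_fun [set: borel T] (fun x => Re (u x)) ->
    measurable_fun [set: borel T] (fun x => Im (u x)) ->
  L2norm2 mu u =
    (\int[mu]_x ((Re (u x)) ^+ 2)%:E + \int[mu]_x ((Im (u x)) ^+ 2)%:E)%E.
Proof.
move=> mR mI; rewrite /L2norm2 /abs2; under eq_integral do rewrite EFinD.
have sq0 (r : R) : (0 <= (r ^+ 2)%:E)%E by rewrite lee_fin sqr_ge0.
by rewrite ge0_integralD //; apply/measurable_EFinP; exact: measurable_funX.
Qed.

Lemma in_L2P u : L2 u <->
  in_L2r mu (fun x => Re (u x)) /\ in_L2r mu (fun x => Im (u x)).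
Proof.
have sq0 (r : R) : (0 <= (r ^+ 2)%:E)%E by rewrite lee_fin sqr_ge0.
split=> [[mR mI N]|[[mR NR] [mI NI]]].
  move: N; rewrite L2norm2_ReIm // => N; split; split=> //.
  + by apply: le_lt_trans N; rewrite leeDl // integral_ge0.
  + by apply: le_lt_trans N; rewrite leeDr // integral_ge0.
by split=> //; rewrite L2norm2_ReIm // lte_add_pinfty.
Qed.

Lemma in_L2_lin a u v : L2 u -> L2 v -> L2 (fun x => a * u x + v x).
Proof.
move=> /in_L2P[Ru Iu] /in_L2P[Rv Iv]; apply/in_L2P; split.
  have := in_L2r_lin 1 1 (in_L2r_lin (Re a) (- Im a) Ru Iu) Rv.
  by congr in_L2r; apply/funext => x; rewrite !complexRI; ring.
have := in_L2r_lin 1 1 (in_L2r_lin (Re a) (Im a) Iu Ru) Iv.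
by congr in_L2r; apply/funext => x; rewrite !complexRI; ring.
Qed.

Lemma in_L20 : L2 (fun=> 0).
Proof.
have L20r : in_L2r mu (fun=> 0).
  split; first exact: measurable_cst.
  by under eq_integral do rewrite expr0n /=; rewrite integral0 ltry.
exact/in_L2P.
Qed.

Lemma in_L2Z a u : L2 u -> L2 (fun x => a * u x).
Proof.
move=> Lu; have := in_L2_lin a Lu in_L20.
by congr in_L2; apply/funext => x; rewrite addr0.
Qed.

Lemma in_L2B u v : L2 u -> L2 v -> L2 (fun x => u x - v x).
Proof.
move=> Lu Lv; have := in_L2_lin (- 1) Lv Lu.
by congr in_L2; apply/funext => x; rewrite mulN1r addrC.
Qed.

Lemma in_L2_sum (I : Type) (r : seq I) (P : pred I) (c : I -> R[i])
    (w : I -> T -> R[i]) : (forall i, L2 (w i)) ->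
  L2 (fun x => \sum_(i <- r | P i) c i * w i x).
Proof.
move=> Lw; elim: r => [|i r IHr].
  by have := in_L20; congr in_L2; apply/funext => x; rewrite big_nil.
case Pi : (P i).
  have := in_L2_lin (c i) (Lw i) IHr.
  by congr in_L2; apply/funext => x; rewrite big_cons Pi.
by move: IHr; congr in_L2; apply/funext => x; rewrite big_cons Pi.
Qed.

Lemma cintegrable_inner u v : L2 u -> L2 v -> cintegrable (fun x => u x * (v x)^*).
Proof.
move=> /in_L2P[Ru Iu] /in_L2P[Rv Iv]; split.
  apply: (integrable_comb (c1 := 1) (c2 := 1) (integrable_L2rM Ru Rv) (integrable_L2rM Iu Iv)).
  by move=> x; rewrite !complexRI; ring.
apply: (integrable_comb (c1 := 1) (c2 := - 1) (integrable_L2rM Iu Rv) (integrable_L2rM Ru Iv)).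
by move=> x; rewrite !complexRI; ring.
Qed.

Lemma inner_linl a u v w : L2 u -> L2 v -> L2 w ->
  << fun x => a * u x + v x, w >> = a * << u, w >> + << v, w >>.
Proof.
move=> Lu Lv Lw.
rewrite /inner -cintegral_lin; try exact: cintegrable_inner.
by congr cintegral; apply/funext => x; ring.
Qed.

Lemma inner_conj u v : L2 u -> L2 v -> << v, u >> = << u, v >>^*.
Proof.
move=> Lu Lv; have [RI II] := cintegrable_inner Lu Lv.
apply: complex_eq; rewrite !complexRI /inner /cintegral /=.
  by apply: eq_Rintegral => x _; rewrite !complexRI; ring.
rewrite (Rintegral_comb (c1 := - 1) (c2 := 0) II II); first ring.
by move=> x; rewrite !complexRI; ring.
Qed.

Lemma inner_linr a u v w : L2 u -> L2 v -> L2 w ->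
  << w, fun x => a * u x + v x >> = a^* * << w, u >> + << w, v >>.
Proof.
move=> Lu Lv Lw; rewrite inner_conj ?inner_linl //; last exact: in_L2_lin.
by rewrite rmorphD rmorphM /= -!inner_conj.
Qed.

End ComplexL2.

(** * Cauchy-Schwarz, orthogonality and completeness *)

Section HilbertSpace.
Context {R : realType} {T : ptopologicalType}.
Variable mu : {measure set (borel T) -> \bar R}.
Implicit Types (u v w : T -> R[i]) (a : R[i]).

Notation L2 := (in_L2 mu).
Notation "<< u , v >>" := (inner mu u v).

Definition norm2 u : R := Re << u, u >>.

Lemma L2norm2E u : L2 u -> L2norm2 mu u = (norm2 u)%:E.
Proof.
move=> Lu; have [_ _ Nu] := Lu.
rewrite /norm2 /inner /cintegral /= /Rintegral /L2norm2.
under [in RHS]eq_integral => x _.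
  rewrite (_ : Re _ = abs2 (u x)); last by rewrite !complexRI /abs2; ring.
  over.
rewrite fineK // ge0_fin_numE //.
by apply: integral_ge0 => x _; rewrite lee_fin abs2_ge0.
Qed.

Lemma innerE u : L2 u -> << u, u >> = (norm2 u)%:C.
Proof.
move=> Lu; apply: complex_eq => //=.
have /(congr1 (@Im R)) := inner_conj Lu Lu; rewrite !complexRI /=; lra.
Qed.

Lemma norm2_ge0 u : 0 <= norm2 u.
Proof.
apply: Rintegral_ge0 => x _; rewrite !complexRI.
by rewrite mulrN opprK -!expr2 addr_ge0 ?sqr_ge0.
Qed.

Lemma norm2_lin a u v : L2 u -> L2 v ->
  norm2 (fun x => a * u x + v x) =
  abs2 a * norm2 u + norm2 v + 2 * Re (a * << u, v >>).
Proof.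
move=> Lu Lv; rewrite /norm2 inner_linl //; last exact: in_L2_lin.
rewrite !inner_linr // (inner_conj Lu Lv) (innerE Lu) (innerE Lv).
by rewrite !complexRI /abs2 /=; ring.
Qed.

Lemma inner0l w : L2 w -> << fun=> 0, w >> = 0.
Proof.
move=> Lw; have L0 := in_L20 mu; have := inner_linl 1 L0 L0 Lw.
rewrite (_ : (fun x => _) = fun=> 0); last by apply/funext => x; rewrite mulr0 addr0.
by rewrite mul1r => /(congr1 (fun z => z - << fun=> 0, w >>)); rewrite addrK subrr.
Qed.

Lemma innerZl a u w : L2 u -> L2 w -> << fun x => a * u x, w >> = a * << u, w >>.
Proof.
move=> Lu Lw; rewrite -[RHS]addr0 -(inner0l Lw) -inner_linl //; last exact: in_L20.
by congr (inner mu _ _); apply/funext => x; rewrite addr0.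
Qed.

Lemma innerZr a u w : L2 u -> L2 w -> << w, fun x => a * u x >> = a^* * << w, u >>.
Proof.
by move=> Lu Lw; rewrite inner_conj ?innerZl ?rmorphM /= -?inner_conj //; exact: in_L2Z.
Qed.

Lemma innerBl u v w : L2 u -> L2 v -> L2 w ->
  << fun x => u x - v x, w >> = << u, w >> - << v, w >>.
Proof.
move=> Lu Lv Lw; rewrite -mulN1r addrC -inner_linl //.
by congr (inner mu _ _); apply/funext => x; rewrite mulN1r addrC.
Qed.

Lemma inner_suml (I : Type) (r : seq I) (P : pred I) (c : I -> R[i])
    (w : I -> T -> R[i]) v : (forall i, L2 (w i)) -> L2 v ->
  << fun x => \sum_(i <- r | P i) c i * w i x, v >> =
  \sum_(i <- r | P i) c i * << w i, v >>.
Proof.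
move=> Lw Lv; elim: r => [|i r IHr].
  rewrite big_nil (_ : (fun x => _) = fun=> 0) ?inner0l //.
  by apply/funext => x; rewrite big_nil.
rewrite big_cons -IHr; case Pi : (P i).
  rewrite -inner_linl //; last exact: in_L2_sum.
  by congr (inner mu _ _); apply/funext => x; rewrite big_cons Pi.
by congr (inner mu _ _); apply/funext => x; rewrite big_cons Pi.
Qed.

Lemma norm2BC u v : norm2 (fun x => u x - v x) = norm2 (fun x => v x - u x).
Proof.
rewrite /norm2 /inner; congr (Re (cintegral _ _)); apply/funext => x.
by rewrite -opprB rmorphN mulrNN.
Qed.

(** The square norm of [- t <<u, v>>^* u + v] is nonnegative for every real [t];
    with [q] the square modulus of [<<u, v>>], this is the quadratic inequality
    [0 <= t ^ 2 q norm2 u + norm2 v - 2 t q], optimal at [t = 1 / norm2 u]. *)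
Lemma cauchy_schwarz u v : L2 u -> L2 v -> abs2 << u, v >> <= norm2 u * norm2 v.
Proof.
move=> Lu Lv.
set q := abs2 << u, v >>.
have key (t : R) : 0 <= t ^+ 2 * q * norm2 u + norm2 v - 2 * t * q.
  have := norm2_ge0 (fun x => (- t%:C * << u, v >>^* ) * u x + v x).
  rewrite norm2_lin // abs2M (_ : abs2 (- t%:C) = t ^+ 2); last first.
    by rewrite /abs2 !complexRI /=; ring.
  rewrite abs2C -/q.
  rewrite -[- _ * _ * _]mulrA [_^* * _]mulrC mul_conj -/q !complexRI /=; lra.
have [A0 B0 q0] : [/\ 0 <= norm2 u, 0 <= norm2 v & 0 <= q].
  by rewrite !norm2_ge0 abs2_ge0.
move: key A0 B0 q0; move: (norm2 u) (norm2 v) q => A B q key A0 B0 q0.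
have [Ae0|/eqP An0] := eqVneq A 0.
  have [->|/eqP qn0] := eqVneq q 0; first by rewrite Ae0 mul0r.
  (* This value of [t] makes the right-hand side equal to [- 1]. *)
  have := key ((B + 1) / (2 * q)).
  rewrite Ae0 mulr0 add0r (_ : _ - _ = - 1); first lra.
  by field; apply/eqP.
have := key A^-1.
rewrite (_ : _ - _ = B - q / A); last by field; apply/eqP.
by rewrite subr_ge0 ler_pdivrMr 1?mulrC // lt_neqAle A0 andbT eq_sym; apply/eqP.
Qed.

Lemma inner_null_l u v : L2 u -> L2 v -> norm2 u = 0 -> << u, v >> = 0.
Proof.
move=> Lu Lv u0; apply: abs2_eq0; apply/eqP; rewrite eq_le abs2_ge0 andbT.
by have := cauchy_schwarz Lu Lv; rewrite u0 mul0r.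
Qed.

(** By Cauchy-Schwarz, the pairing with [u] is continuous. *)
Lemma closed_span_orth (S : set (T -> R[i])) u v :
  S `<=` L2 -> L2 u -> (forall w, S w -> << w, u >> = 0) ->
  closed_span mu S v -> << v, u >> = 0.
Proof.
move=> SL Lu Su [Lv approx]; apply: abs2_eq0; apply/eqP.
rewrite eq_le abs2_ge0 andbT; apply/ler_addgt0Pr => e e0; rewrite add0r.
have [n [c [w [Sw]]]] := approx (e / (norm2 u + 1)) (divr_gt0 e0 (ltr_wpDl (norm2_ge0 u) ltr01)).
have Lw i : L2 (w i) by exact: SL.
have Ls : L2 (fun x => \sum_(i < n) c i * w i x) by exact: in_L2_sum.
have Ld := in_L2B Lv Ls.
rewrite L2norm2E // lte_fin => small.
have := cauchy_schwarz Ld Lu; rewrite innerBl // inner_suml //.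
rewrite big1 ?subr0; last by move=> i _; rewrite Su ?mulr0.
move=> /le_trans; apply; apply: le_trans (ler_wpM2r (norm2_ge0 u) (ltW small)) _.
have u0 := norm2_ge0 u.
rewrite -mulrA ler_piMr ?(ltW e0) // mulrC ler_pdivrMr ?mul1r; lra.
Qed.

(** Follows from the real case, applied to the real and imaginary parts. *)
Lemma L2_complete (f : nat -> T -> R[i]) :
  (forall n, L2 (f n)) ->
  (forall e : R, 0 < e -> exists N, forall i j, (N <= i)%N -> (N <= j)%N ->
     norm2 (fun x => f i x - f j x) <= e) ->
  exists2 g, L2 g & forall e : R, 0 < e -> exists N, forall i, (N <= i)%N ->
     norm2 (fun x => f i x - g x) <= e.
Proof.
move=> Lf cauchy.
have L2R n := (iffLR (in_L2P mu (f n)) (Lf n)).1.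
have L2I n := (iffLR (in_L2P mu (f n)) (Lf n)).2.
have split_norm2 u : L2 u ->
    (norm2 u)%:E = (\int[mu]_x ((Re (u x)) ^+ 2)%:E + \int[mu]_x ((Im (u x)) ^+ 2)%:E)%E.
  by move=> Lu; have [mR mI _] := Lu; rewrite -L2norm2E // L2norm2_ReIm.
have int_ge0 (h : T -> R) : (0 <= \int[mu]_x ((h x) ^+ 2)%:E)%E.
  by apply: integral_ge0 => x _; rewrite lee_fin sqr_ge0.
have [|g1 Lg1 g1P] := L2r_complete L2R.
  move=> e e0; have [N NP] := cauchy e e0; exists N => i j Ni Nj.
  apply: le_trans (_ : (norm2 (fun x => f i x - f j x))%:E <= _)%E; last first.
    by rewrite lee_fin NP.
  rewrite split_norm2; last exact: in_L2B.
  by under eq_integral do rewrite -ReN -ReD; rewrite leeDl.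
have [|g2 Lg2 g2P] := L2r_complete L2I.
  move=> e e0; have [N NP] := cauchy e e0; exists N => i j Ni Nj.
  apply: le_trans (_ : (norm2 (fun x => f i x - f j x))%:E <= _)%E; last first.
    by rewrite lee_fin NP.
  rewrite split_norm2; last exact: in_L2B.
  by under eq_integral do rewrite -ImN -ImD; rewrite leeDr.
have Lg : L2 (fun x => g1 x +i* g2 x) by apply/in_L2P.
exists (fun x => g1 x +i* g2 x) => // e e0.
have e20 : 0 < e / 2 by rewrite divr_gt0.
have [N1 N1P] := g1P _ e20; have [N2 N2P] := g2P _ e20.
exists (maxn N1 N2) => i; rewrite geq_max => /andP[i1 i2].
rewrite -lee_fin split_norm2; last exact: in_L2B.
under eq_integral do rewrite ReD ReN /=.
under [X in (_ + X)%E]eq_integral do rewrite ImD ImN /=.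
rewrite [e]splitr EFinD; apply: leeD; [exact: N1P|exact: N2P].
Qed.

End HilbertSpace.

(** * Orthonormal bases *)

Section Series.
Context {R : realType}.

Lemma nneseries_tail_lt (a : nat -> \bar R) (e : R) : (forall n, 0 <= a n)%E ->
  (\sum_(n <oo) a n < +oo)%E -> 0 < e ->
  exists N, (\sum_(N <= n <oo) a n < e%:E)%E.
Proof.
move=> a0 fin e0.
have /fine_cvgP[finN cv] := nneseries_tail_cvg fin (fun n _ => a0 n).
move/cvgrPdist_lt : cv => /(_ e e0) cv.
have [N _ /(_ N (leqnn N))[fN cN]] := filterI finN cv.
exists N; rewrite -(fineK fN) lte_fin.
by apply: le_lt_trans cN; rewrite sub0r normrN ler_norm.
Qed.
End Series.

Section OrthonormalBasis.
Context {R : realType} {T : ptopologicalType}.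
Variables (mu : {measure set (borel T) -> \bar R}) (phi : nat -> T -> R[i]).
Implicit Types (u v w : T -> R[i]) (a : R[i]) (c : nat -> R[i]) (r : seq nat).

Notation L2 := (in_L2 mu).
Notation "<< u , v >>" := (inner mu u v).

Hypothesis Lphi : forall n, L2 (phi n).
Hypothesis phi_orthonormal : forall n m, << phi n, phi m >> = (n == m)%:R.
Hypothesis phi_complete : forall u, L2 u -> closed_span mu (range phi) u.

Definition expansion c r : T -> R[i] := fun x => \sum_(i <- r) c i * phi i x.

Lemma in_L2_expansion c r : L2 (expansion c r).
Proof. exact: in_L2_sum. Qed.
Hint Resolve in_L2_expansion : core.

Lemma inner_expansion c r n : uniq r ->
  << expansion c r, phi n >> = if n \in r then c n else 0.
Proof.
move=> ur; rewrite inner_suml //; case: ifPn => nr.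
  rewrite (bigD1_seq n) //= phi_orthonormal eqxx mulr1 big1 ?addr0 // => i.
  by rewrite phi_orthonormal => /negbTE ->; rewrite mulr0.
rewrite big1_seq // => i /andP[_ ir].
rewrite phi_orthonormal (_ : (i == n) = false) ?mulr0 //.
by apply/negP => /eqP ein; rewrite -ein ir in nr.
Qed.

Lemma norm2_expansion c r : uniq r ->
  norm2 mu (expansion c r) = \sum_(i <- r) abs2 (c i).
Proof.
move=> ur; rewrite /norm2 {1}/expansion inner_suml //.
rewrite (big_morph _ (@ReD R) (erefl _)); apply: eq_big_seq => i ir.
by rewrite inner_conj // inner_expansion // ir mul_conj.
Qed.

Lemma norm2_pythagoras u r : L2 u -> uniq r ->
  norm2 mu u = norm2 mu (fun x => u x - expansion (fun n => << u, phi n >>) r x) +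
               \sum_(i <- r) abs2 << u, phi i >>.
Proof.
move=> Lu ur; set S := expansion _ r.
have LS : L2 S by exact: in_L2_expansion.
have Ld : L2 (fun x => u x - S x) by exact: in_L2B.
rewrite -norm2_expansion //.
have := norm2_lin 1 Ld (in_L2_expansion (fun n => << u, phi n >>) r).
rewrite mul1r inner_conj // inner_suml // big1_seq => [|i /andP[_ ir]]; last first.
  rewrite [<< phi i, _ >>]inner_conj // innerBl // inner_expansion // ir subrr.
  by rewrite rmorph0 mulr0.
rewrite rmorph0 /= mulr0 addr0 /abs2 /= expr0n expr1n addr0 mul1r => <-.
by congr norm2; apply/funext => x; rewrite mul1r subrK.
Qed.

(** Completeness of the basis puts [u] in the closed span of vectors to which it
    is orthogonal, so that [u] is orthogonal to itself. *)
Lemma coef_eq0 u : L2 u -> (forall n, << u, phi n >> = 0) -> norm2 mu u = 0.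
Proof.
move=> Lu cu; rewrite /norm2 (closed_span_orth (S := range phi)) //.
- by move=> _ [n _ <-].
- by move=> _ [n _ <-]; rewrite inner_conj // cu rmorph0.
- exact: phi_complete.
Qed.

(** The partial sums are Cauchy since the square norm of a block is the sum
    of the square moduli of its coefficients.  The convergence is part of the conclusion: it gives Parseval's
    identity and shows that a limit of eigenfunctions is in their closed span. *)
Lemma riesz_fischer c : (\sum_(n <oo) (abs2 (c n))%:E < +oo)%E ->
  exists v, [/\ L2 v, forall n, << v, phi n >> = c n &
    forall e : R, 0 < e -> exists N, forall i, (N <= i)%N ->
      norm2 mu (fun x => expansion c (index_iota 0 i) x - v x) <= e].
Proof.
move=> sumc; have c0 n : (0 <= (abs2 (c n))%:E)%E by rewrite lee_fin abs2_ge0.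
have tail N i j : (N <= i)%N -> (i <= j)%N ->
    ((norm2 mu (fun x => expansion c (index_iota 0 i) x -
                         expansion c (index_iota 0 j) x))%:E <=
    \sum_(N <= n <oo) (abs2 (c n))%:E)%E.
  move=> Ni ij; rewrite norm2BC.
  rewrite (_ : (fun x => _) = expansion c (index_iota i j)); last first.
    apply/funext => x; rewrite /expansion (big_cat_nat (n := i)) //=.
    by ring.
  rewrite norm2_expansion ?iota_uniq // -sumEFin.
  apply: le_trans (nneseries_lim_ge j (fun n _ _ => c0 n)).
  rewrite [leRHS](big_cat_nat (n := i)) //= leeDr //.
  exact: sume_ge0.
have [|v Lv vP] := L2_complete (fun i => in_L2_expansion c (index_iota 0 i)).
  move=> e e0; have [N NP] := nneseries_tail_lt c0 sumc e0.
  exists N => i j Ni Nj; rewrite -lee_fin; apply: le_trans (ltW NP).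
  case/orP: (leq_total i j) => ij; first exact: tail.
  by rewrite norm2BC; exact: tail.
exists v; split => // n; apply/eqP; rewrite -subr_eq0; apply/eqP/abs2_eq0/eqP.
rewrite eq_le abs2_ge0 andbT; apply/ler_addgt0Pr => e e0; rewrite add0r.
have [N NP] := vP e e0.
pose i := maxn N n.+1.
apply: le_trans (NP i (leq_maxl _ _)); rewrite norm2BC.
have Ld := in_L2B Lv (in_L2_expansion c (index_iota 0 i)).
apply: le_trans (_ : norm2 mu _ * norm2 mu (phi n) <= _); last first.
  by rewrite [X in _ * X]/norm2 phi_orthonormal eqxx mulr1.
apply: le_trans (cauchy_schwarz Ld (Lphi n)).
rewrite innerBl // inner_expansion ?iota_uniq // mem_index_iota /=.
by rewrite (leq_trans (ltnSn n) (leq_maxr N n.+1)).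
Qed.

Lemma bessel u : L2 u ->
  (\sum_(n <oo) (abs2 << u, phi n >>)%:E <= (norm2 mu u)%:E)%E.
Proof.
move=> Lu; apply: lime_le.
  by apply: is_cvg_nneseries => n _ _; rewrite lee_fin abs2_ge0.
apply: nearW => N; rewrite sumEFin lee_fin (norm2_pythagoras Lu (iota_uniq 0 (N - 0))).
by rewrite lerDr norm2_ge0.
Qed.

(** Bessel gives one inequality.  For the other one, the function that
    [riesz_fischer] builds from the coefficients of [u] differs from [u] by a null
    function, so that the partial expansions also converge to [u]. *)
Lemma parseval u : L2 u ->
  L2norm2 mu u = (\sum_(n <oo) (abs2 << u, phi n >>)%:E)%E.
Proof.
move=> Lu; rewrite L2norm2E //; apply/eqP; rewrite eq_le bessel // andbT.
have [v [Lv cv vP]] := riesz_fischer (le_lt_trans (bessel Lu) (ltry _)).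
have Luv := in_L2B Lu Lv.
have uv0 : norm2 mu (fun x => u x - v x) = 0.
  by apply: coef_eq0 => // n; rewrite innerBl // cv subrr.
apply/lee_addgt0Pr => e e0; have [N NP] := vP e e0.
rewrite (norm2_pythagoras Lu (iota_uniq 0 (N - 0))) EFinD addeC.
apply: leeD.
  rewrite -sumEFin; apply: nneseries_lim_ge => n _ _; rewrite lee_fin; exact: abs2_ge0.
rewrite lee_fin; apply: le_trans (NP N (leqnn N)); rewrite [leRHS]norm2BC.
set S := expansion _ _.
have LS : L2 S by exact: in_L2_expansion.
have Lvs : L2 (fun x => v x - S x) by exact: in_L2B.
have := norm2_lin 1 Luv Lvs; rewrite uv0 mulr0 add0r mul1r inner_null_l //= mulr0 addr0.
move=> <-; rewrite le_eqVlt; apply/orP; left; apply/eqP.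
by congr (norm2 mu _); apply/funext => x; rewrite mul1r addrA subrK.
Qed.

(** Functions with the same coefficients differ by a null function, which no
    pairing sees. *)
Lemma coef_inj u v w : L2 u -> L2 v -> L2 w ->
  (forall n, << u, phi n >> = << v, phi n >>) -> << u, w >> = << v, w >>.
Proof.
move=> Lu Lv Lw cuv; apply/eqP; rewrite -subr_eq0 -innerBl //.
rewrite inner_null_l //; first exact: in_L2B.
by apply: coef_eq0 => [|n]; [exact: in_L2B|rewrite innerBl // cuv subrr].
Qed.

(** The polarized Parseval identity, in the case where all its terms vanish. *)
Lemma disjoint_coef_orth u v : L2 u -> L2 v ->
  (forall n, << u, phi n >> = 0 \/ << v, phi n >> = 0) -> << u, v >> = 0.
Proof.
move=> Lu Lv duv.
have [w [Lw cw wP]] := riesz_fischer (le_lt_trans (bessel Lu) (ltry _)).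
rewrite (coef_inj Lu Lw Lv (fun n => esym (cw n))); apply/abs2_eq0/eqP.
rewrite eq_le abs2_ge0 andbT; apply/ler_addgt0Pr => e e0; rewrite add0r.
have v0 := norm2_ge0 mu v.
have [N NP] := wP (e / (norm2 mu v + 1)) (divr_gt0 e0 (ltr_wpDl v0 ltr01)).
have := NP N (leqnn N); set S := expansion _ _ => small.
have LS : L2 S by exact: in_L2_expansion.
have := cauchy_schwarz (in_L2B LS Lw) Lv; rewrite innerBl // inner_suml //.
rewrite big1 ?sub0r => [|i _]; last first.
  case: (duv i) => [->|vi]; first by rewrite mul0r.
  by rewrite (inner_conj Lv) // vi rmorph0 mulr0.
rewrite -mulN1r abs2M (_ : abs2 (- 1) = 1) ?mul1r; last first.
  by rewrite /abs2 /= oppr0 sqrrN expr1n expr0n addr0.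
move=> /le_trans; apply; apply: le_trans (ler_wpM2r v0 small) _.
rewrite -mulrA ler_piMr ?(ltW e0) // mulrC ler_pdivrMr ?mul1r; lra.
Qed.

End OrthonormalBasis.

(** * Energies are nonnegative and homogeneous of degree two *)

Section QuadraticEnergy.
Context {R : realType}.
Import HBNNSimple.

(** Two consequences matter: the polarized form is symmetric, which makes
    eigenfunctions of distinct eigenvalues orthogonal, and its diagonal is
    nonnegative, which makes eigenvalues nonnegative.  The property is stable
    under all the constructions of spaces (gluing, blow-ups, products). *)
Definition quadratic (V : Type) (E : (V -> R) -> \bar R) :=
  (forall u, 0 <= E u)%E /\
  (forall a u, E (fun x => a * u x) = ((a ^+ 2)%:E * E u)%E).

(** The missing inequality is the assumed one for the factor [a^-1]. *)
Lemma quadratic_le (V : Type) (E : (V -> R) -> \bar R) :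
  (forall u, 0 <= E u)%E -> E (fun=> 0) = 0%E ->
  (forall a u, a != 0%R -> E (fun x => a * u x)%R <= (a ^+ 2)%:E * E u)%E ->
  quadratic E.
Proof.
move=> E0 Ezero Ele; split=> // a u; have [->|a0] := eqVneq a 0.
  rewrite (_ : (fun x => _) = fun=> 0) ?Ezero ?expr0n ?mul0e //.
  by apply/funext => x; rewrite mul0r.
apply/eqP; rewrite eq_le Ele //=.
have a20 : 0 < a ^+ 2 by rewrite exprn_even_gt0.
have := Ele a^-1 (fun x => a * u x) (invr_neq0 a0).
rewrite (_ : (fun x => _) = u); last by apply/funext => x; rewrite mulKf.
rewrite exprVn => le.
apply: le_trans (lee_wpmul2l _ le) _; first by rewrite lee_fin ltW.
by rewrite muleA -EFinM mulfV ?mul1e // gt_eqF.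
Qed.

Lemma quadratic_comp (V W : Type) (E : (V -> R) -> \bar R) (f : V -> W) :
  quadratic E -> quadratic (fun u : W -> R => E (u \o f)).
Proof. by move=> [E0 EZ]; split=> // a u; rewrite -EZ. Qed.

Lemma quadratic_zero (V : Type) (E : (V -> R) -> \bar R) :
  quadratic E -> E (fun=> 0) = 0%E.
Proof.
move=> [_ EZ]; have := EZ 0 (fun=> 0); rewrite expr0n mul0e => <-.
by congr E; apply/funext => x; rewrite mul0r.
Qed.

Lemma quadratic_scale (V : Type) (E : (V -> R) -> \bar R) (c : R) : 0 <= c ->
  quadratic E -> quadratic (fun u => c%:E * E u)%E.
Proof.
by move=> c0 [E0 EZ]; split=> [u|a u]; rewrite ?mule_ge0 // EZ muleCA.
Qed.

Lemma quadratic_esum (V : Type) (I : choiceType) (E : I -> (V -> R) -> \bar R) :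
  (forall i, quadratic (E i)) ->
  quadratic (fun u => \esum_(i in [set: I]) E i u)%E.
Proof.
move=> qE; apply: quadratic_le => [u||a u a0].
- by apply: esum_ge0 => i _; case: (qE i).
- by apply: esum1 => i _; exact: quadratic_zero.
apply: ge_ereal_sup => _ [J finJ <-].
rewrite (eq_fsbigr (fun i => ((a ^+ 2)%:E * E i u)%E)); last first.
  by move=> i _; case: (qE i).
rewrite -ge0_mule_fsumr; last by move=> i; case: (qE i).
apply: lee_wpmul2l; first by rewrite lee_fin sqr_ge0.
by apply: ereal_sup_ubound; exists J.
Qed.

Lemma quadratic_sup (V I : Type) (i0 : I) (E : I -> (V -> R) -> \bar R) :
  (forall i, quadratic (E i)) ->
  quadratic (fun u => ereal_sup [set E i u | i in [set: I]]).
Proof.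
move=> qE; apply: quadratic_le => [u||a u a0].
- by apply: (@le_trans _ _ (E i0 u)); [case: (qE i0)|apply: ereal_sup_ubound; exists i0].
- rewrite (_ : [set _ | _ in _] = [set 0%E]) ?ereal_sup1 //.
  apply/seteqP; split=> [_ [i _ <-]|_ ->] /=; first exact: quadratic_zero.
  by exists i0 => //; exact: quadratic_zero.
apply: ge_ereal_sup => _ [i _ <-]; rewrite (qE i).2.
apply: lee_wpmul2l; first by rewrite lee_fin sqr_ge0.
by apply: ereal_sup_ubound; exists i.
Qed.

(** Stated for arbitrary functions, because the energies of the slices of a
    function on a product need not depend measurably on the slice.  The integral
    being a supremum over simple functions below the integrand, dividing such a
    function by [c] proves the bound. *)
Lemma le_integral_scale d (T : measurableType d) (mu : {measure set T -> \bar R})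
    (c : R) (f g : T -> \bar R) : 0 < c ->
  (forall x, 0 <= f x)%E -> (forall x, 0 <= g x <= c%:E * f x)%E ->
  (\int[mu]_x g x <= c%:E * \int[mu]_x f x)%E.
Proof.
move=> c0 f0 gf; have g0 x : (0 <= g x)%E by have /andP[] := gf x.
rewrite (ge0_integralTE mu g0) (ge0_integralTE mu f0).
apply: ge_ereal_sup => _ [h /= hg <-].
have ci0 : 0 <= c^-1 by rewrite invr_ge0 ltW.
rewrite (_ : sintegral mu h = (c%:E * sintegral mu (scale_nnsfun h ci0))%E); last first.
  rewrite (_ : sintegral mu (scale_nnsfun h ci0) = (c^-1)%:E * sintegral mu h)%E; last first.
    exact: (sintegralrM mu c^-1 h).
  by rewrite muleA -EFinM mulfV ?mul1e // gt_eqF.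
apply: lee_wpmul2l; first by rewrite lee_fin ltW.
apply: ereal_sup_ubound; exists (scale_nnsfun h ci0) => //= x.
have /andP[_ gx] := gf x; have := le_trans (hg x) gx => le.
rewrite EFinM; apply: le_trans (lee_wpmul2l _ le) _; first by rewrite lee_fin.
by rewrite muleA -EFinM mulVf ?mul1e // gt_eqF.
Qed.

Lemma quadratic_integral (V : Type) d (T : measurableType d)
    (mu : {measure set T -> \bar R}) (E : T -> (V -> R) -> \bar R) :
  (forall t, quadratic (E t)) ->
  quadratic (fun u => \int[mu]_t E t u)%E.
Proof.
move=> qE; apply: quadratic_le => [u||a u a0].
- by apply: integral_ge0 => t _; case: (qE t).
- by under eq_integral do rewrite (quadratic_zero (qE _)); rewrite integral0.
apply: le_integral_scale => [|t|t].
- by rewrite exprn_even_gt0.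
- by case: (qE t).
- by case: (qE t) => E0 EZ; rewrite EZ lexx andbT mule_ge0 // lee_fin sqr_ge0.
Qed.

Lemma quadraticD (V : Type) (E1 E2 : (V -> R) -> \bar R) :
  quadratic E1 -> quadratic E2 -> quadratic (fun u => E1 u + E2 u)%E.
Proof.
move=> [E10 E1Z] [E20 E2Z]; split=> [u|a u]; first exact: adde_ge0.
by rewrite E1Z E2Z ge0_muleDr.
Qed.

Lemma quadratic_energy_ae (X : energy_space R) :
  quadratic (sp_energy X) -> quadratic (@energy_ae R X).
Proof.
move=> qE; have [E0 EZ] := qE; apply: quadratic_le => [u||a u a0].
- by apply: le_ereal_inf_tmp => _ [v _ <-].
- apply/eqP; rewrite eq_le; apply/andP; split.
    apply: ereal_inf_lbound; exists (fun=> 0); last exact: quadratic_zero.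
    exact: aeW.
  by apply: le_ereal_inf_tmp => _ [v _ <-].
have a20 : 0 < a ^+ 2 by rewrite exprn_even_gt0.
rewrite /energy_ae -ereal_inf_pZl //.
apply: le_ereal_inf_tmp => _ [_ [v vu <-] <-].
rewrite -EZ; apply: ereal_inf_lbound; exists (fun x => a * v x) => //=.
by apply: (@filterS _ _ (ae_filter_ringOfSetsType (sp_mu X)) _ _ _ vu) => x ->.
Qed.

Lemma quadratic_power (X Y : energy_space R) (k : nat) :
  quadratic (sp_energy X) -> power_of X k Y -> quadratic (sp_energy Y).
Proof.
move=> qX; elim=> // n Z nu _ qZ _.
apply: quadraticD; apply: quadratic_integral => t; apply: quadratic_comp.
  exact: quadratic_energy_ae.
exact: quadratic_energy_ae.
Qed.

Lemma quadratic_fractal (A : pcf_fractal R) : quadratic (fr_energy A).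
Proof. by case: (fr_dirichlet A). Qed.

Lemma quadratic_fractafold (A : pcf_fractal R) (X : energy_space R) :
  fractafold A X -> quadratic (sp_energy X).
Proof.
move=> [I [iota [[_ _ _ [_ EX _]] _]]].
rewrite (_ : sp_energy X = fun u => (\esum_(a in [set: I]) fr_energy A (u \o iota a))%E).
  by apply: quadratic_esum => i; apply: quadratic_comp; exact: quadratic_fractal.
exact/funext.
Qed.

Lemma quadratic_blowup (A : pcf_fractal R) (X : energy_space R) :
  infinite_blowup A X -> quadratic (sp_energy X).
Proof.
move=> [w [j [psi [_ _ _ _ [_ EX _ _]]]]].
rewrite (funext EX); apply: (quadratic_sup 0%N) => m; apply: quadratic_scale.
  by apply: prodr_ge0 => i _; exact: ltW (fr_r_gt0 _).
by apply: quadratic_comp; exact: quadratic_fractal.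
Qed.

Lemma quadratic_admissible (A : pcf_fractal R) (k : nat) (X : energy_space R) :
  admissible A k X -> quadratic (sp_energy X).
Proof.
case=> [[_ [/quadratic_fractafold]]|[_ /quadratic_blowup]|[_ [Y [AY]]]] //.
apply: quadratic_power.
by case: AY => [/quadratic_fractafold|/quadratic_blowup].
Qed.

End QuadraticEnergy.

(** * Spectral calculus in terms of coefficients *)

Section SpectralTheory.
Context {R : realType}.
Variable X : energy_space R.
Notation eigenspace := Defs.eigenspace.
Notation mu := (sp_mu X).
Notation L2 := (in_L2 mu).
Notation "<< u , v >>" := (inner mu u v).
Implicit Types (u v w : pt X -> R[i]).

Hypothesis qE : quadratic (sp_energy X).

Lemma energyN (u : pt X -> R) : sp_energy X (fun x => - u x) = sp_energy X u.
Proof.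
have [_ EZ] := qE; have := EZ (- 1) u; rewrite sqrrN expr1n mul1e => <-.
by congr sp_energy; apply/funext => x; rewrite mulN1r.
Qed.

Lemma energy_bilC (u v : pt X -> R) : energy_bil u v = energy_bil v u.
Proof.
rewrite /energy_bil -[sp_energy X (u \- v)]energyN; congr ((fine _ - fine _) / 4).
  by congr sp_energy; apply/funext => x /=; rewrite addrC.
by congr sp_energy; apply/funext => x /=; rewrite opprB.
Qed.

(** When the energy is infinite, both sides are zero, the value of [fine] there. *)
Lemma energy_bil_diag (u : pt X -> R) : energy_bil u u = fine (sp_energy X u).
Proof.
have [_ EZ] := qE; rewrite /energy_bil.
have -> : (u \- u) = fun=> 0 by apply/funext => x /=; rewrite subrr.
have -> : (u \+ u) = fun x => 2 * u x by apply/funext => x /=; rewrite mulr_natl mulr2n.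
rewrite quadratic_zero // EZ /= subr0.
case: (sp_energy X u) => [r||] /=; first by field.
  by rewrite gt0_muley ?mul0r // lte_fin exprn_gt0.
by rewrite gt0_muleNy ?mul0r // lte_fin exprn_gt0.
Qed.

Lemma laplacian_eigen (l : R) (u v : pt X -> R) :
  laplacian u (fun x => - (l * u x)) -> in_L2r mu v -> (sp_energy X v < +oo)%E ->
  energy_bil u v = l * \int[mu]_x (u x * v x).
Proof.
move=> [Lu _ _ H] Lv Ev; rewrite H //.
have Iuv := integrable_L2rM Lu Lv.
rewrite (Rintegral_comb (c1 := - l) (c2 := 0) Iuv Iuv) => [|x]; last by ring.
by ring.
Qed.

(** The symmetric form of [u] and [v] is both [l] and [k] times their pairing. *)
Lemma eigen_orth_real (l k : R) (u v : pt X -> R) : l != k ->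
  laplacian u (fun x => - (l * u x)) -> laplacian v (fun x => - (k * v x)) ->
  \int[mu]_x (u x * v x) = 0.
Proof.
move=> lk Du Dv; have [Lu Eu _ _] := Du; have [Lv Ev _ _] := Dv.
have := laplacian_eigen Du Lv Ev; rewrite energy_bilC (laplacian_eigen Dv Lu Eu).
under eq_Rintegral do rewrite mulrC.
move=> /eqP; rewrite -subr_eq0 -mulrBl mulf_eq0 subr_eq0 eq_sym (negbTE lk) => /eqP.
by [].
Qed.

Lemma eigenspace_L2 (l : R) u : eigenspace l u -> L2 u.
Proof. by move=> [[Lr _ _ _] [Li _ _ _]]; apply/in_L2P. Qed.

Lemma eigenspace_orth (l k : R) u v : l != k ->
  eigenspace l u -> eigenspace k v -> << u, v >> = 0.
Proof.
move=> lk eu ev; have [Ru Iu] := eu; have [Rv Iv] := ev.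
have [LRu LIu] := iffLR (in_L2P mu u) (eigenspace_L2 eu).
have [LRv LIv] := iffLR (in_L2P mu v) (eigenspace_L2 ev).
apply: complex_eq => /=.
  rewrite (Rintegral_comb (c1 := 1) (c2 := 1) (integrable_L2rM LRu LRv) (integrable_L2rM LIu LIv)).
    by rewrite (eigen_orth_real lk Ru Rv) (eigen_orth_real lk Iu Iv) !mulr0 addr0.
  by move=> x; rewrite !complexRI; ring.
rewrite (Rintegral_comb (c1 := 1) (c2 := - 1) (integrable_L2rM LIu LRv) (integrable_L2rM LRu LIv)).
  by rewrite (eigen_orth_real lk Iu Rv) (eigen_orth_real lk Ru Iv) !mulr0 addr0.
by move=> x; rewrite !complexRI; ring.
Qed.

(** The product is the energy of the real part plus that of the imaginary part. *)
Lemma eigenvalue_ge0 (l : R) u : eigenspace l u -> 0 <= l * norm2 mu u.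
Proof.
move=> eu; have [Ru Iu] := eu.
have [LRu LIu] := iffLR (in_L2P mu u) (eigenspace_L2 eu).
have [E0 _] := qE; have [_ ER _ _] := Ru; have [_ EI _ _] := Iu.
rewrite /norm2 /=.
rewrite (Rintegral_comb (c1 := 1) (c2 := 1) (integrable_L2rM LRu LRu) (integrable_L2rM LIu LIu)).
  rewrite !mul1r mulrDr -(laplacian_eigen Ru LRu ER) -(laplacian_eigen Iu LIu EI).
  by rewrite !energy_bil_diag addr_ge0 // fine_ge0.
by move=> x; rewrite !complexRI; ring.
Qed.

Lemma eigenspace0 (l : R) : eigenspace (X := X) l (fun=> 0).
Proof.
have L0 : in_L2r mu (fun=> 0) by have [] := iffLR (in_L2P _ _) (in_L20 mu).
have D0 : laplacian (X := X) (fun=> 0) (fun=> - (l * 0)).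
  split=> //; first by rewrite quadratic_zero ?ltry.
    by rewrite mulr0 oppr0.
  move=> v _ _; rewrite /energy_bil.
  have -> : ((fun=> 0) \+ v) = v by apply/funext => x /=; rewrite add0r.
  have -> : ((fun=> 0) \- v) = fun x => - v x by apply/funext => x /=; rewrite sub0r.
  rewrite energyN subrr mul0r.
  under eq_Rintegral do rewrite mulr0 oppr0 mul0r.
  by rewrite /Rintegral integral0 oppr0.
by split.
Qed.

Variables (phi : nat -> pt X -> R[i]) (lam : nat -> R).
Hypothesis hphi : eigenbasis phi lam.

Lemma eigenbasis_L2 n : L2 (phi n).
Proof. by have [h _ _ _] := hphi; exact: eigenspace_L2 (h n). Qed.

Lemma eigenbasis_orthonormal n m : << phi n, phi m >> = (n == m)%:R.
Proof. by have [_ + _ _] := hphi. Qed.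

Lemma eigenbasis_complete u : L2 u -> closed_span mu (range phi) u.
Proof. by have [_ _ + _] := hphi; exact. Qed.

Hint Resolve eigenbasis_L2 eigenbasis_orthonormal eigenbasis_complete : core.

Lemma lam_ge0 n : 0 <= lam n.
Proof.
have [h _ _ _] := hphi; have := eigenvalue_ge0 (h n).
by rewrite /norm2 eigenbasis_orthonormal eqxx mulr1.
Qed.

Lemma Lambda_lam n : Lambda X (lam n).
Proof.
have [h _ _ _] := hphi; exists (phi n) => //; rewrite L2norm2E //.
by rewrite /norm2 eigenbasis_orthonormal eqxx; apply/eqP; rewrite eqe oner_eq0.
Qed.

(** The function with the coefficients of [u] at the indices of eigenvalue [l] is
    an orthogonal projection of [u], hence the choice in [orth_proj] is made in a
    nonempty set; and the defining properties of a projection determine the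
    coefficients of whichever element is chosen. *)
Lemma spectral_projP l u : L2 u -> L2 (spectral_proj l u) /\
  forall n, << spectral_proj l u, phi n >> = if lam n == l then << u, phi n >> else 0.
Proof.
move=> Lu; have [h _ _ _] := hphi.
pose c n := if lam n == l then << u, phi n >> else 0.
have : exists v, closed_span mu (eigenspace l) v /\
    forall w, eigenspace l w -> << fun x => u x - v x, w >> = 0.
  have [|v [Lv cv vP]] := @riesz_fischer _ _ mu phi eigenbasis_L2 eigenbasis_orthonormal c.
    apply: le_lt_trans (_ : \sum_(n <oo) (abs2 << u, phi n >>)%:E < +oo)%E.
      apply: lee_nneseries => [n _ _|n _]; first by rewrite lee_fin abs2_ge0.
      by rewrite /c; case: ifP => _; rewrite lee_fin // abs20 abs2_ge0.
    by rewrite (le_lt_trans (bessel eigenbasis_L2 eigenbasis_orthonormal Lu)) ?ltry.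
  exists v; split.
    split=> // e e0; have e20 : 0 < e / 2 by rewrite divr_gt0.
    have [N NP] := vP _ e20.
    (* The indices of another eigenvalue are sent to the zero eigenfunction. *)
    exists N, c, (fun i => if lam i == l then phi i else fun=> 0); split.
      by move=> i; case: eqP => [<-|_]; [exact: h|exact: eigenspace0].
    rewrite (_ : (fun x => _) = (fun x => v x - expansion phi c (index_iota 0 N) x)); last first.
      apply/funext => x; rewrite /expansion big_mkord; congr (_ - _); apply: eq_bigr => i _.
      by rewrite /c; case: eqP => // _; rewrite !mul0r.
    rewrite L2norm2E; last by apply: in_L2B => //; exact: in_L2_expansion.
    rewrite lte_fin norm2BC; apply: le_lt_trans (NP N (leqnn N)) _; lra.
  move=> w ew; have Lw := eigenspace_L2 ew.
  apply: (disjoint_coef_orth eigenbasis_L2 eigenbasis_orthonormal eigenbasis_complete) => // [|n].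
    exact: in_L2B.
  rewrite innerBl // cv /c; case: eqP => [_|/eqP ln]; [left|right].
    by rewrite subrr.
  by rewrite inner_conj ?(eigenspace_orth _ (h n) ew) ?rmorph0.
move=> exv; have := xgetPex (fun=> 0) exv.
rewrite -[xget _ _]/(spectral_proj l u).
move: (spectral_proj l u) => v [Sv orth]; have Lv := Sv.1; split => // n.
case: eqP => [ln|/eqP ln].
  have := orth (phi n); rewrite innerBl // => orthn; apply/esym/eqP.
  by rewrite -subr_eq0; apply/eqP/orthn; rewrite -ln; exact: h.
apply: closed_span_orth Sv => // [w|w ew]; first exact: eigenspace_L2.
rewrite (inner_conj (eigenspace_L2 (h n)) (eigenspace_L2 ew)).
by rewrite (eigenspace_orth ln (h n) ew) rmorph0.
Qed.

(** Parseval for each spectral projection; the sum over the eigenvalues of the sums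
    over the indices of each of them is the sum over all indices. *)
Lemma sobolev_norm2E (d s : R) u : L2 u ->
  sobolev_norm2 d s u =
  (\sum_(n <oo) ((1 + lam n) `^ (2 * s / (d + 1)) * abs2 << u, phi n >>)%:E)%E.
Proof.
move=> Lu; pose a n := ((1 + lam n) `^ (2 * s / (d + 1)) * abs2 << u, phi n >>)%:E.
have a0 n : (0 <= a n)%E by rewrite lee_fin mulr_ge0 ?powR_ge0 ?abs2_ge0.
pose J l := [set n | lam n = l].
rewrite /sobolev_norm2 (eq_esum (b := fun l => \esum_(n in J l) a n)) => [|l _].
  rewrite esum_esum // (@reindex_esum _ _ _ [set: nat] _ (fun n => (lam n, n))).
    by rewrite -nneseries_esumT.
  split.
  - by move=> n _ /=; split => //; exact: Lambda_lam.
  - by move=> n m _ _ [].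
  - by move=> [l n] [_ lE]; exists n => //; congr pair; exact: lE.
have [Lp cp] := spectral_projP l Lu.
rewrite (parseval eigenbasis_L2 eigenbasis_orthonormal eigenbasis_complete Lp).
rewrite -nneseriesZl; last by move=> n _; rewrite lee_fin abs2_ge0.
rewrite nneseries_esumT; last first.
  by move=> n; rewrite -EFinM lee_fin mulr_ge0 ?powR_ge0 ?abs2_ge0.
rewrite [RHS]esum_mkcond; apply: eq_esum => n _; rewrite cp -EFinM /a /J.
case: eqP => [<-|ln]; first by rewrite mem_set.
by rewrite abs20 mulr0 memNset.
Qed.

(** Beyond a finite set of eigenvalues that contains the nonzero ones among the
    first [N], the remainder of the spectral sum only has coefficients of index
    at least [N], and the same ones as [v]: Parseval bounds it by a tail of the
    series of [v]. *)
Lemma spectral_sumP (q : R -> R[i]) u v : L2 u -> L2 v ->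
  (forall n, << v, phi n >> = (if lam n == 0 then 0 else q (lam n)) * << u, phi n >>) ->
  spectral_sum (Lambda X `\ 0) q u v.
Proof.
move=> Lu Lv cv; split => // e e0.
have c0 n : (0 <= (abs2 << v, phi n >>)%:E)%E by rewrite lee_fin abs2_ge0.
have fin : (\sum_(n <oo) (abs2 << v, phi n >>)%:E < +oo)%E.
  exact: le_lt_trans (bessel eigenbasis_L2 eigenbasis_orthonormal Lv) (ltry _).
have [N NP] := nneseries_tail_lt c0 fin e0.
exists [fset lam i | i in [seq i <- iota 0 N | lam i != 0]]%fset; split.
  move=> l /imfsetP[i /=]; rewrite mem_filter => /andP[li _] ->.
  by split; [exact: Lambda_lam|exact/eqP].
move=> J J0J JL; set S := fun x => \sum_(l <- J) q l * spectral_proj l u x.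
have LS : L2 S by apply: in_L2_sum => l; have [] := spectral_projP l Lu.
have Ld : L2 (fun x => v x - S x) by exact: in_L2B.
rewrite (parseval eigenbasis_L2 eigenbasis_orthonormal eigenbasis_complete Ld).
have cS n : << S, phi n >> = if lam n \in J then << v, phi n >> else 0.
  rewrite inner_suml //; last by move=> l; have [] := spectral_projP l Lu.
  under eq_bigr => l _ do rewrite (spectral_projP l Lu).2.
  case: ifPn => lJ.
    rewrite (bigD1_seq (lam n)) ?fset_uniq //= eqxx big1 ?addr0.
      rewrite cv; case: eqP => // l0.
      by have [_] := JL _ lJ; rewrite /= l0.
    by move=> l ll; rewrite eq_sym (negbTE ll) mulr0.
  rewrite big1_seq // => l /andP[_ lJ']; case: eqP => [ln|_]; last by rewrite mulr0.
  by rewrite ln lJ' in lJ.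
apply: le_lt_trans NP.
rewrite (nneseries_split 0 N) //; last by move=> k _; rewrite lee_fin abs2_ge0.
rewrite big1_seq ?add0e ?add0n => [|i /andP[_]]; last first.
  rewrite mem_index_iota /= => iN; rewrite innerBl // cS.
  case: ifPn => [_|nJ]; first by rewrite subrr abs20.
  rewrite subr0 cv; case: eqP => [_|/eqP l0]; first by rewrite mul0r abs20.
  case/negP: nJ; apply: (J0J (lam i)); apply/imfsetP; exists i => //=.
  by rewrite mem_filter l0 mem_iota.
apply: lee_nneseries => [k _ _|k _]; first by rewrite lee_fin abs2_ge0.
rewrite lee_fin innerBl // cS; case: ifP => _; last by rewrite subr0.
by rewrite subrr abs20 abs2_ge0.
Qed.

End SpectralTheory.

(** * Sobolev spaces as weighted sequence spaces *)

Section SobolevSequences.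
Context {R : realType}.
Variable X : energy_space R.
Notation mu := (sp_mu X).
Notation L2 := (in_L2 mu).
Notation "<< u , v >>" := (inner mu u v).
Implicit Types (u v w : pt X -> R[i]) (b c : nat -> R[i]).

Variables (phi : nat -> pt X -> R[i]) (lam : nat -> R) (d : R).
Hypotheses (qE : quadratic (sp_energy X)) (hphi : eigenbasis phi lam).

Let Lphi := eigenbasis_L2 hphi.
Let ophi := eigenbasis_orthonormal hphi.
Let cphi := eigenbasis_complete hphi.

Definition weight (s : R) n := (1 + lam n) `^ (2 * s / (d + 1)).

Lemma one_lam_gt0 n : 0 < 1 + lam n.
Proof. by rewrite ltr_pwDl ?(lam_ge0 qE hphi). Qed.

Lemma weight_gt0 s n : 0 < weight s n.
Proof. by rewrite powR_gt0 ?one_lam_gt0. Qed.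

Lemma weightD s t n : weight (s + t) n = weight s n * weight t n.
Proof.
rewrite /weight -powRD; last by rewrite (gt_eqF (one_lam_gt0 n)) implybT.
by rewrite mulrDr mulrDl.
Qed.

Lemma weight_sqr s n : ((1 + lam n) `^ (s / (d + 1))) ^+ 2 = weight s n.
Proof.
rewrite expr2 -powRD; last by rewrite (gt_eqF (one_lam_gt0 n)) implybT.
by rewrite /weight -mulrA mulr_natl mulr2n.
Qed.

Lemma weightNK s n : weight (- s) n * weight s n = 1.
Proof. by rewrite -weightD addNr /weight mulr0 mul0r powRr0. Qed.

Lemma weight_ge1 s n : 0 < d -> 0 <= s -> 1 <= weight s n.
Proof.
move=> d0 s0; rewrite -(powRr0 (1 + lam n)); apply: ler_powR.
  by rewrite lerDl (lam_ge0 qE hphi).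
by rewrite divr_ge0 ?mulr_ge0 // addr_ge0 // ltW.
Qed.

Definition weighted_norm2 s b := (\sum_(n <oo) (weight s n * abs2 (b n))%:E)%E.

Lemma weighted_ge0 s b n : (0 <= (weight s n * abs2 (b n))%:E)%E.
Proof. by rewrite lee_fin mulr_ge0 ?abs2_ge0 // ltW ?weight_gt0. Qed.
Hint Resolve weighted_ge0 : core.

Lemma sobolev_fun_finite s u N : L2 u ->
    (forall n, (N <= n)%N -> << u, phi n >> = 0) ->
  sobolev_norm2 d s u = (\sum_(0 <= n < N) weight s n * abs2 << u, phi n >>)%:E /\
  sobolev_fun d s u.
Proof.
move=> Lu u0; suff E : sobolev_norm2 d s u =
    (\sum_(0 <= n < N) weight s n * abs2 << u, phi n >>)%:E.
  by split=> //; split=> //; rewrite E ltry.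
rewrite (sobolev_norm2E qE hphi) // (nneseries_split 0 N); last first.
  by move=> n _; exact: (weighted_ge0 s (fun n => << u, phi n >>)).
rewrite add0n sumEFin -/(weight s _) [X in (_ + X)%E](_ : _ = 0%E) ?adde0 //.
apply: eseries0 => n Nn _.
by rewrite u0 // abs20 mulr0.
Qed.

Lemma sobolev_fun_phi s n : sobolev_fun d s (phi n).
Proof.
apply: (sobolev_fun_finite s (N := n.+1) (Lphi n) _).2 => k nk.
by rewrite ophi (ltn_eqF nk).
Qed.

(** Functionals on Sobolev spaces are conjugate-linear. *)
Lemma sobolev_dual_expansion t f c N : sobolev_dual d t f ->
  f (expansion phi c (index_iota 0 N)) = \sum_(0 <= n < N) (c n)^* * f (phi n).
Proof.
move=> [flin _].
have sob k : sobolev_fun d t (expansion phi c (index_iota 0 k)).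
  apply: (sobolev_fun_finite t (N := k) (in_L2_expansion Lphi c _) _).2 => n kn.
  rewrite (inner_expansion Lphi ophi) ?iota_uniq // mem_index_iota /=.
  by rewrite ltnNge kn.
elim: N => [|N IHN].
  rewrite [RHS]big_nil; have := flin 1 _ _ (sob 0%N) (sob 0%N).
  set z := expansion _ _ _; rewrite (_ : (fun x => _) = z).
    move=> /(congr1 (fun y => y - f z)); rewrite addrK subrr.
    by rewrite rmorph1 mul1r.
  by apply/funext => x; rewrite /z /expansion big_nil mulr0 addr0.
rewrite big_nat_recr //= -IHN addrC -(flin _ _ _ (sobolev_fun_phi t N) (sob N)).
by congr f; apply/funext => x; rewrite /expansion big_nat_recr //= addrC.
Qed.

(** [f] is tested on the truncations [w] of the function with coefficients
    [weight (- t) n * f (phi n)].  Both [f w] and the square Sobolev norm of [w]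
    equal the partial sum [S] of the series to be bounded, so the continuity of
    [f] reads [S ^ 2 <= C S], whence [S <= C] uniformly in the truncation. *)
Lemma sobolev_dual_coef t f : sobolev_dual d t f ->
  (weighted_norm2 (- t) (fun n => f (phi n)) < +oo)%E.
Proof.
move=> df; have [flin [C fC]] := df.
suff bound N : \sum_(0 <= n < N) weight (- t) n * abs2 (f (phi n)) <= `|C|.
  apply: (@le_lt_trans _ _ (`|C|%:E)); last exact: ltry.
  apply: lime_le; last first.
    by apply: nearW => N; rewrite sumEFin lee_fin.
  by apply: is_cvg_nneseries => n _ _; exact: (weighted_ge0 _ (fun n => f (phi n))).
pose c n := (weight (- t) n)%:C * f (phi n).
pose w := expansion phi c (index_iota 0 N).
have Lw : L2 w by exact: in_L2_expansion.
have cw n : << w, phi n >> = if (n < N)%N then c n else 0.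
  by rewrite (inner_expansion Lphi ophi) ?iota_uniq // mem_index_iota.
have [|Ew sw] := @sobolev_fun_finite t w N Lw.
  by move=> n Nn; rewrite cw ltnNge Nn.
set S := \sum_(_ <= _ < _) _.
have ES : \sum_(0 <= n < N) weight t n * abs2 << w, phi n >> = S.
  apply: eq_big_nat => n /andP[_ nN]; rewrite cw nN abs2M abs2_real expr2.
  by rewrite !mulrA [weight t n * _]mulrC weightNK mul1r.
have := fC w sw; rewrite Ew ES -EFinM lee_fin (sobolev_dual_expansion c N df).
rewrite (eq_bigr (fun n => (weight (- t) n * abs2 (f (phi n)))%:C)); last first.
  move=> n _; rewrite /c rmorphM /= -mulrA [X in _ * X]mulrC mul_conj.
  by apply: complex_eq; rewrite !complexRI /=; ring.
rewrite (_ : \sum_(_ <= _ < _) _ = S%:C); last first.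
  rewrite /S (big_morph (fun x : R => x%:C) (id1 := 0) (op1 := +%R)) // => x y.
  by apply: complex_eq => /=; rewrite ?addr0.
rewrite abs2_real => le.
have S0 : 0 <= S.
  by apply: sumr_ge0 => n _; rewrite mulr_ge0 ?abs2_ge0 // ltW ?weight_gt0.
have [->|Sn0] := eqVneq S 0; first exact: normr_ge0.
apply: le_trans (ler_norm C); rewrite -(ler_pM2r (x := S)) -?expr2 //.
by rewrite lt_neqAle eq_sym Sn0.
Qed.

(** The pairing of [b] with a function [w] of [H^t] is realized as an inner
    product [<<h, J w>>], by moving half of the weight from one factor to the
    other: [h] has the coefficients of [b] divided by [(1 + lam) ^ (t / (d + 1))]
    and [J w] those of [w] multiplied by it, and both are square-summable.  The
    continuity of the functional is then the Cauchy-Schwarz inequality. *)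
Lemma sobolev_dual_of_coef t b : (weighted_norm2 (- t) b < +oo)%E ->
  exists2 f, sobolev_dual d t f & forall n, f (phi n) = b n.
Proof.
move=> sumb; pose r s n := ((1 + lam n) `^ (s / (d + 1)))%:C.
have abs2r s n : abs2 (r s n) = weight s n by rewrite abs2_real weight_sqr.
have [h [Lh ch _]] : exists h, [/\ L2 h,
    forall n, << h, phi n >> = r (- t) n * b n & True].
  have [|h [Lh ch _]] := riesz_fischer Lphi ophi (c := fun n => r (- t) n * b n).
    by under eq_eseriesr do rewrite abs2M abs2r.
  by exists h.
pose isJ w v := L2 v /\ forall n, << v, phi n >> = r t n * << w, phi n >>.
have exJ w : sobolev_fun d t w -> exists v, isJ w v.
  move=> [Lw sw]; have [|v [Lv cv _]] :=
      riesz_fischer Lphi ophi (c := fun n => r t n * << w, phi n >>).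
    under eq_eseriesr do rewrite abs2M abs2r.
    by rewrite (sobolev_norm2E qE hphi) in sw.
  by exists v.
pose J w := xget (fun=> 0) (isJ w).
have JP w : sobolev_fun d t w -> isJ w (J w) by move=> /exJ; exact: xgetPex.
pose f w := << h, J w >>.
have inner_coef u v : L2 u -> L2 v -> (forall n, << u, phi n >> = << v, phi n >>) ->
    << h, u >> = << h, v >>.
  move=> Lu Lv uv; rewrite (inner_conj Lu Lh) (inner_conj Lv Lh).
  by rewrite (coef_inj Lphi cphi Lu Lv Lh uv).
exists f; last first.
  move=> n; have [LJ cJ] := JP _ (sobolev_fun_phi t n).
  rewrite /f (inner_coef _ (fun x => r t n * phi n x)) //; last 2 first.
  - exact: in_L2Z.
  - move=> k; rewrite cJ innerZl // ophi; case: eqP => [->//|_].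
    by rewrite !mulr0.
  rewrite innerZr // ch mulrA (_ : _ * r (- t) n = 1) ?mul1r //.
  rewrite /r; apply: complex_eq; rewrite !complexRI /= ?oppr0 ?mulr0 ?mul0r ?subr0 ?addr0 //.
  rewrite -powRD; last by rewrite (gt_eqF (one_lam_gt0 n)) implybT.
  by rewrite mulNr subrr powRr0.
split.
  move=> a u v su sv; have [Lu _] := su; have [Lv _] := sv.
  have [LJu cJu] := JP _ su; have [LJv cJv] := JP _ sv.
  have Lc : L2 (fun x => a * J u x + J v x) by exact: in_L2_lin.
  have cc n : << fun x => a * J u x + J v x, phi n >> =
              r t n * << fun x => a * u x + v x, phi n >>.
    by rewrite !inner_linl // cJu cJv; ring.
  have [LJ cJ] : isJ (fun x => a * u x + v x) (J (fun x => a * u x + v x)).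
    by apply: xgetPex; exists (fun x => a * J u x + J v x).
  by rewrite /f -inner_linr //; apply: inner_coef => // n; rewrite cc cJ.
exists (norm2 mu h) => u su; have [Lu _] := su; have [LJ cJ] := JP _ su.
rewrite (sobolev_norm2E qE hphi) //.
have := cauchy_schwarz Lh LJ; rewrite -lee_fin => /le_trans; apply.
rewrite EFinM -(L2norm2E LJ) lee_wpmul2l ?lee_fin ?norm2_ge0 //.
rewrite (parseval Lphi ophi cphi LJ).
by under eq_eseriesr do rewrite cJ abs2M abs2r.
Qed.


(** For [s >= 0] this is the expression of the Sobolev norm by coefficients, and
    for [s < 0] the bound on functionals of [H^(- s)]. *)
Lemma sobolev_coef s g : sobolev d s g ->
  (weighted_norm2 s (coefficient phi g) < +oo)%E.
Proof.
case: g => [u|f] /= [s0 H].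
  by have [Lu] := H; rewrite (sobolev_norm2E qE hphi).
by have := sobolev_dual_coef H; rewrite opprK.
Qed.

(** For [s >= 0] the weights are at least one, so that the sequence is
    square-summable and defines a function; for [s < 0] it defines a functional. *)
Lemma sobolev_of_coef s b : 0 < d -> (weighted_norm2 s b < +oo)%E ->
  exists g, sobolev d s g /\ forall n, coefficient phi g n = b n.
Proof.
move=> d0 sumb; have [s0|s0] := leP 0 s.
  have [|v [Lv cv _]] := riesz_fischer Lphi ophi (c := b).
    apply: le_lt_trans sumb; apply: lee_nneseries => [n _ _|n _].
      by rewrite lee_fin abs2_ge0.
    by rewrite lee_fin ler_peMl ?abs2_ge0 ?weight_ge1.
  exists (Fn v); split => //; split => //; split => //.
  by rewrite (sobolev_norm2E qE hphi) //; under eq_eseriesr do rewrite cv.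
have [|f df fb] := @sobolev_dual_of_coef (- s) b; first by rewrite opprK.
by exists (Dist f).
Qed.

(** The symbol estimate of order zero, [`|p(l)| <= C (1 + l) ^ (m / (d + 1))],
    says that the square modulus of [p (lam n)] is at most [C ^ 2 weight m n]. *)
Lemma weighted_norm2_symbol m p s b : symbol_class d m p ->
  (weighted_norm2 s b < +oo)%E ->
  (weighted_norm2 (s - m)%R
     (fun n => (if lam n == 0 then 0 else p (lam n)) * b n)%R < +oo)%E.
Proof.
move=> [_ /(_ 0%N)[C C0 pC]] sumb.
apply: (@le_lt_trans _ _ ((C ^+ 2)%:E * weighted_norm2 s b)%E); last first.
  by apply: lte_mul_pinfty => //; rewrite lee_fin sqr_ge0.
rewrite /weighted_norm2 -nneseriesZl => [|n _]; last exact: weighted_ge0.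
apply: lee_nneseries => [n _ _|n _]; first by rewrite lee_fin mulr_ge0 ?abs2_ge0 // ltW ?weight_gt0.
rewrite -EFinM lee_fin; case: eqP => [_|/eqP l0].
  rewrite mul0r abs20 mulr0 mulr_ge0 ?sqr_ge0 // mulr_ge0 ?abs2_ge0 //.
  by rewrite ltW ?weight_gt0.
have lgt : 0 < lam n by rewrite lt_neqAle eq_sym l0 (lam_ge0 qE hphi).
have : abs2 (p (lam n)) <= C ^+ 2 * weight m n.
  rewrite -weight_sqr -exprMn -[leLHS]sqr_sqrtr ?abs2_ge0 //.
  rewrite ler_pXn2r ?nnegrE ?sqrtr_ge0 ?mulr_ge0 ?powR_ge0 ?(ltW C0) //.
  exact: pC.
rewrite abs2M => le; rewrite weightD mulrA.
have sm : weight s n = weight s n * (weight (- m) n * weight m n).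
  by rewrite weightNK mulr1.
rewrite [weight s n in leRHS]sm.
have h1 := weight_gt0 s n; have h2 := weight_gt0 (- m) n.
have := abs2_ge0 (b n).
have -> : C ^+ 2 * (weight s n * (weight (- m) n * weight m n) * abs2 (b n)) =
  weight s n * weight (- m) n * (C ^+ 2 * weight m n) * abs2 (b n) by ring.
move=> b0; rewrite ler_wpM2r // ler_wpM2l // mulr_ge0 // ltW //.
Qed.

End SobolevSequences.

Unset Implicit Arguments.

(** * Boundedness of the pseudo-differential operators *)

Theorem proposition4p3 (R : realType) (A : pcf_fractal R) (k : nat) (X : energy_space R)
    (hX : admissible A k X)
    (phi : nat -> pt X -> R[i]) (lam : nat -> R) (hphi : eigenbasis phi lam)
    (d : R) (d_gt0 : 0 < d) (hheat : heat_kernel_bound X k d)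
    (m : R) (p : R -> R[i]) (hp : symbol_class d m p) (s : R)
    (g : gen_fun X) (hg : sobolev d s g) :
  exists2 g' : gen_fun X, sobolev d (s - m) g' & psi_do phi lam p g g'.
Proof.
have qE := quadratic_admissible hX.
have sumg := sobolev_coef qE hphi hg.
have [g' [sg' cg']] := sobolev_of_coef qE hphi d_gt0
  (weighted_norm2_symbol qE hphi hp sumg).
exists g' => //; case: g g' hg sumg sg' cg' => [u|f] [v|f'] //= hg _ sg' cg'.
by apply: (spectral_sumP qE hphi) => //; [case: hg => _ []|case: sg' => _ []].
Qed.
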